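(* Let $M$ be a $\mathfrak g$-manifold. Let $\varphi\in\Omega^p_{\mathrm{hor}}(M;\mathfrak g)^{\mathfrak g}$ and let $\psi\in\Omega^q_{\mathrm{hor}}(M;\mathfrak g)^{\mathfrak g}$. Then: (1) $\zeta_\psi$ is horizontal and $\mathfrak g$-equivariant in the sense that the Lie derivative along any fundamental vector field vanishes: $\mathcal L_{\zeta_X}(\zeta_\psi)=[\zeta_X,\zeta_\psi]=0$ for all $X\in\mathfrak g$. (2) $[\zeta_\varphi,\zeta_\psi]=-\zeta_{[\varphi,\psi]^\wedge}$, so $\zeta:\Omega_{\mathrm{hor}}(M;\mathfrak g)^{\mathfrak g}\to\Omega(M;TM)$ is an anti-homomorphism of graded Lie algebras. If $\omega\in\Omega^1(M;\mathfrak g)^{\mathfrak g}$ is a principal connection form with principal connection $\Phi=\zeta_\omega$, then furthermore: (3) $[\Phi,\zeta_\psi]=-\zeta_{d\psi+[\omega,\psi]^\wedge}$. (4) $\tfrac12[\Phi,\Phi]=-\zeta_{d\omega+\frac12[\omega,\omega]^\wedge}$.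
   Context: $\mathfrak g$ is a finite-dimensional real Lie algebra. A $\mathfrak g$-manifold is a smooth manifold $M$ with a Lie algebra homomorphism $\zeta:\mathfrak g\to\mathfrak X(M)$; $\zeta_x:\mathfrak g\to T_xM$ is $X\mapsto\zeta_X(x)$. A (vector- or $TM$-valued) form is horizontal if killed by $i_{\zeta_X}$ for all $X\in\mathfrak g$. $\Omega^p(M;\mathfrak g)^{\mathfrak g}$ consists of forms with $\mathcal L_{\zeta_X}\varphi=-\operatorname{ad}(X)\circ\varphi$ for all $X$; $\Omega^p_{\mathrm{hor}}(M;\mathfrak g)^{\mathfrak g}$ of those that are also horizontal. For $\varphi\in\Omega^p(M;\mathfrak g)$, $\zeta_\varphi\in\Omega^p(M;TM)$ is $(\zeta_\varphi)_x(\xi_1,\dots,\xi_p)=\zeta_{\varphi_x(\xi_1,\dots,\xi_p)}(x)$. The bracket on $\Omega(M;\mathfrak g)$ is $$[\varphi,\psi]^\wedge(\xi_1,\dots,\xi_{p+q})=\tfrac1{p!\,q!}\sum_\sigma\operatorname{sign}(\sigma)[\varphi(\xi_{\sigma1},\dots,\xi_{\sigma p}),\psi(\xi_{\sigma(p+1)},\dots,\xi_{\sigma(p+q)})]_{\mathfrak g}.$$ On $\Omega(M;TM)$, $[\ ,\ ]$ is the Frölicher–Nijenhuis bracket, determined by $\mathbb R$-bilinearity, locality and, for $\alpha\in\Omega^k(M)$, $\beta\in\Omega^\ell(M)$, $X,Y\in\mathfrak X(M)$, $$[\alpha\otimes X,\beta\otimes Y]=\alpha\wedge\beta\otimes[X,Y]+\alpha\wedge\mathcal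 L_X\beta\otimes Y-\mathcal L_Y\alpha\wedge\beta\otimes X+(-1)^k(d\alpha\wedge i_X\beta\otimes Y+i_Y\alpha\wedge d\beta\otimes X).$$ A principal connection form is $\omega\in\Omega^1(M;\mathfrak g)^{\mathfrak g}$ with $\zeta_x\circ\omega_x\circ\zeta_x=\zeta_x$ for all $x\in M$; then $\Phi=\zeta_\omega\in\Omega^1(M;TM)$. *)

(* Defs.v *)
From HB Require Import structures.
From mathcomp Require Import all_boot all_order all_algebra.
From mathcomp Require Import fingroup perm.
From mathcomp Require Import boolp classical_sets functions reals.
From mathcomp Require Import topology normedtype derive.
From mathcomp Require Import ring.

Set Implicit Arguments.
Unset Strict Implicit.
Unset Printing Implicit Defensive.

Import Order.TTheory GRing.Theory Num.Theory.
Import numFieldNormedType.Exports.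

Local Open Scope classical_set_scope.
Local Open Scope ring_scope.

HB.mixin Record isLieAlgebra (R : realType) V of Vector R V := {
  lie : V -> V -> V ;
  lie_linearl : forall v : V, linear (lie^~ v) ;
  lie_linearr : forall v : V, linear (lie v) ;
  liexx : forall v : V, lie v v = 0 ;
  lie_jacobi : forall u v w : V,
    lie u (lie v w) + lie v (lie w u) + lie w (lie u v) = 0
}.

#[short(type="lieAlgType")]
HB.structure Definition LieAlgebra (R : realType) :=
  {V of Vector R V & isLieAlgebra R V}.

(* f is of class C^k on A (used for A open): all iterated directional         *)
(* derivatives of order at most k exist and are continuous on A.              *)
Fixpoint Ck_on (R : realType) (n k : nat) (A : set 'rV[R]_n)
    (f : 'rV[R]_n -> R^o) : Prop :=
  (forall x, A x -> {for x, continuous f}) /\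
  match k with
  | 0 => True
  | k'.+1 => forall v, (forall x, A x -> derivable f x v) /\
                       Ck_on k' A (fun x => 'D_v f x)
  end.

Definition smooth_on (R : realType) (n : nat) (A : set 'rV[R]_n)
  (f : 'rV[R]_n -> R^o) : Prop := forall k, Ck_on k A f.

(* [chart i] and [chart_inv i] are only meaningful on [dom i] and on          *)
(* [chart i @` dom i] respectively.                                           *)
Record manifold (R : realType) (n : nat) := Manifold {
  carrier :> topologicalType ;
  chart_index : Type ;
  dom : chart_index -> set carrier ;
  chart : chart_index -> carrier -> 'rV[R]_n ;
  chart_inv : chart_index -> 'rV[R]_n -> carrier ;
  manifold_hausdorff : hausdorff_space carrier ;
  manifold_second_countable : @second_countable carrier ;
  dom_open : forall i, open (dom i) ;
  dom_cover : \bigcup_i dom i = setT ;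
  chart_image_open : forall i, open (chart i @` dom i) ;
  chartK : forall i x, dom i x -> chart_inv i (chart i x) = x ;
  chart_continuous : forall i x, dom i x -> {for x, continuous (chart i)} ;
  chart_inv_continuous : forall i y, (chart i @` dom i) y ->
    {for y, continuous (chart_inv i)} ;
  chart_transition_smooth : forall i j (c : 'I_n),
    smooth_on (chart i @` (dom i `&` dom j))
      (fun y => chart j (chart_inv i y) 0 c)
}.

Section SmoothOnTheory.
Variables (R : realType) (n : nat) (A : set 'rV[R]_n).
Hypothesis oA : open A.
Implicit Types (f g : 'rV[R]_n -> R^o).

Lemma Ck_onW k f : Ck_on k.+1 A f -> Ck_on k A f.
Proof.
elim: k f => [|k IH] f [cf Df]; split=> // v.
have [df D2f] := Df v; split=> //; exact: IH.
Qed.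

Let near_of_on f g x : (forall x, A x -> f x = g x) -> A x ->
  \near x, f x = g x.
Proof.
move=> fg Ax; have : nbhs x A by exact: open_nbhs_nbhs.
by apply: filterS => y /fg.
Qed.

Lemma eq_Ck_on k f g : (forall x, A x -> f x = g x) ->
  Ck_on k A f -> Ck_on k A g.
Proof.
elim: k f g => [|k IH] f g fg [cf Df]; split=> //.
- move=> x Ax; rewrite /prop_for /continuous_at -(fg _ Ax).
  exact: cvg_trans (near_eq_cvg (near_of_on fg Ax)) (cf x Ax).
- move=> x Ax; rewrite /prop_for /continuous_at -(fg _ Ax).
  exact: cvg_trans (near_eq_cvg (near_of_on fg Ax)) (cf x Ax).
- move=> v; have [df D2f] := Df v; split.
    by move=> x Ax; apply: (near_eq_derivable (near_of_on fg Ax)); exact: df.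
  by apply: (IH _ _ _ D2f) => x Ax; apply: near_eq_derive; exact: (near_of_on fg Ax).
Qed.

Lemma Ck_on_cst k (c : R) : Ck_on k A (fun=> c).
Proof.
elim: k c => [|k IH] c; split=> //; try by move=> x _; exact: cst_continuous.
move=> v; split; first by move=> x _; exact: (derivable_cst c x v).
by apply: (eq_Ck_on _ (IH 0)) => x Ax; rewrite (derive_cst c x v).
Qed.

Lemma Ck_onD k f g : Ck_on k A f -> Ck_on k A g -> Ck_on k A (f + g).
Proof.
elim: k f g => [|k IH] f g [cf Df] [cg Dg]; split=> //.
- by move=> x Ax; exact: cvgD (cf x Ax) (cg x Ax).
- by move=> x Ax; exact: cvgD (cf x Ax) (cg x Ax).
move=> v; have [df D2f] := Df v; have [dg D2g] := Dg v; split.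
  by move=> x Ax; apply: derivableD; [exact: df | exact: dg].
by apply: (eq_Ck_on _ (IH _ _ D2f D2g)) => x Ax; rewrite deriveD //; auto.
Qed.

Lemma Ck_onM k f g : Ck_on k A f -> Ck_on k A g -> Ck_on k A (f \* g).
Proof.
elim: k f g => [|k IH] f g.
  by move=> [cf _] [cg _]; split=> // x Ax; exact: cvgM (cf x Ax) (cg x Ax).
move=> Cf Cg; have Cf' := Ck_onW Cf; have Cg' := Ck_onW Cg.
move: Cf Cg => [cf Df] [cg Dg]; split.
  by move=> x Ax; exact: cvgM (cf x Ax) (cg x Ax).
move=> v; have [df D2f] := Df v; have [dg D2g] := Dg v; split.
  by move=> x Ax; apply: derivableM; [exact: df | exact: dg].
apply: (eq_Ck_on _ (Ck_onD (IH _ _ Cf' D2g) (IH _ _ Cg' D2f))) => x Ax.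
by rewrite deriveM //; auto.
Qed.

End SmoothOnTheory.

Section SmoothFunctions.
Variables (R : realType) (n : nat) (M : manifold R n).
Implicit Types (V : vectType R).

Definition smooth (f : M -> R) : Prop := forall i : chart_index M,
  smooth_on (chart i @` dom i) (fun y => f (chart_inv i y)).

Lemma smooth_cst (c : R) : smooth (fun=> c).
Proof. by move=> i k; apply: Ck_on_cst; exact: chart_image_open. Qed.

Lemma smoothD f g : smooth f -> smooth g -> smooth (fun x => f x + g x).
Proof.
by move=> sf sg i k; apply: (Ck_onD _ (sf i k) (sg i k)); exact: chart_image_open.
Qed.

Lemma smoothM f g : smooth f -> smooth g -> smooth (fun x => f x * g x).
Proof.
by move=> sf sg i k; apply: (Ck_onM _ (sf i k) (sg i k)); exact: chart_image_open.
Qed.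

Lemma smooth_sum I (r : seq I) (F : I -> M -> R) :
  (forall i, smooth (F i)) -> smooth (fun x => \sum_(i <- r) F i x).
Proof.
move=> sF; elim: r => [|i r IH].
  by under eq_fun do rewrite big_nil; exact: smooth_cst.
by under eq_fun do rewrite big_cons; exact: (smoothD (sF i) IH).
Qed.

(* The ring C^oo(M). *)
Definition smooth_pred : {pred M -> R} := fun f => `[< smooth f >].

Record Cinf := MkCinf { cinf_fun :> M -> R ; _ : cinf_fun \in smooth_pred }.

HB.instance Definition _ := [isSub for cinf_fun].
HB.instance Definition _ := [Choice of Cinf by <:].

Fact smooth_subring_closed : subring_closed smooth_pred.
Proof.
split.
- by apply/asboolP; exact: smooth_cst.
- move=> f g /asboolP sf /asboolP sg; apply/asboolP; apply: smoothD => //.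
  by have := smoothM (smooth_cst (-1)) sg; under eq_fun do rewrite mulN1r.
- by move=> f g /asboolP sf /asboolP sg; apply/asboolP; exact: smoothM.
Qed.

HB.instance Definition _ :=
  GRing.SubChoice_isSubComPzRing.Build _ _ Cinf smooth_subring_closed.

Lemma cinfP (f : Cinf) : smooth f.
Proof. by case: f => f /= /asboolP. Qed.

Definition mk_cinf (f : M -> R) (sf : smooth f) : Cinf :=
  MkCinf (asboolT sf).

Definition cinf_cst (c : R) : Cinf := mk_cinf (smooth_cst c).

End SmoothFunctions.

(* A map into a finite-dimensional vector space is smooth iff its composition *)
(* with every linear functional is.  C^oo(M; V) is a C^oo(M)-module under     *)
(* pointwise multiplication.                                                  *)
Section VectorValued.
Variables (R : realType) (n : nat) (M : manifold R n) (V : vectType R).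

Definition vsmooth (f : M -> V) : Prop :=
  forall l : {scalar V}, smooth (fun x => l (f x)).

Definition vsmooth_pred : {pred M -> V} := fun f => `[< vsmooth f >].

Record Cinfv := MkCinfv { cinfv_fun :> M -> V ; _ : cinfv_fun \in vsmooth_pred }.

HB.instance Definition _ := [isSub for cinfv_fun].
HB.instance Definition _ := [Choice of Cinfv by <:].

Lemma vsmoothD (f g : M -> V) :
  vsmooth f -> vsmooth g -> vsmooth (fun x => f x + g x).
Proof.
by move=> sf sg l; under eq_fun do rewrite linearD; exact: (smoothD (sf l) (sg l)).
Qed.

Lemma vsmoothZ (a : M -> R) (f : M -> V) :
  smooth a -> vsmooth f -> vsmooth (fun x => a x *: f x).
Proof.
by move=> sa sf l; under eq_fun do rewrite linearZ; exact: (smoothM sa (sf l)).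
Qed.

Lemma vsmooth_cst (v : V) : vsmooth (fun=> v).
Proof. by move=> l; exact: smooth_cst. Qed.

Lemma vsmooth_sum I (r : seq I) (F : I -> M -> V) :
  (forall i, vsmooth (F i)) -> vsmooth (fun x => \sum_(i <- r) F i x).
Proof.
move=> sF l; under eq_fun do rewrite linear_sum.
exact: (smooth_sum r (fun i => sF i l)).
Qed.

Fact vsmooth_zmod_closed : zmod_closed vsmooth_pred.
Proof.
split; first by apply/asboolP; exact: vsmooth_cst.
move=> f g /asboolP sf /asboolP sg; apply/asboolP; apply: vsmoothD => //.
by have := vsmoothZ (smooth_cst (M := M) (-1)) sg; under eq_fun do rewrite scaleN1r.
Qed.

HB.instance Definition _ :=
  GRing.SubChoice_isSubZmodule.Build _ _ Cinfv vsmooth_zmod_closed.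

Lemma cinfvP (f : Cinfv) : vsmooth f.
Proof. by case: f => f /= /asboolP. Qed.

Definition mk_cinfv (f : M -> V) (sf : vsmooth f) : Cinfv :=
  MkCinfv (asboolT sf).

Definition cinfv_cst (v : V) : Cinfv := mk_cinfv (vsmooth_cst v).

Definition cinfv_scale (a : Cinf M) (f : Cinfv) : Cinfv :=
  mk_cinfv (vsmoothZ (cinfP a) (cinfvP f)).

Fact cinfv_scaleA a b f :
  cinfv_scale a (cinfv_scale b f) = cinfv_scale (a * b) f.
Proof. by apply/val_inj/funext => x /=; rewrite scalerA. Qed.

Fact cinfv_scale1 : left_id 1 cinfv_scale.
Proof. by move=> f; apply/val_inj/funext => x /=; rewrite scale1r. Qed.

Fact cinfv_scaleDr : right_distributive cinfv_scale +%R.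
Proof. by move=> a f g; apply/val_inj/funext => x /=; rewrite scalerDr. Qed.

Fact cinfv_scaleDl f : {morph cinfv_scale^~ f : a b / a + b}.
Proof. by move=> a b; apply/val_inj/funext => x /=; rewrite scalerDl. Qed.

HB.instance Definition _ := GRing.Zmodule_isLmodule.Build (Cinf M) Cinfv
  cinfv_scaleA cinfv_scale1 cinfv_scaleDr cinfv_scaleDl.

Fact smooth_coord (f : Cinfv) (a : 'I_(\dim {:V})) :
  smooth (fun x => coord (vbasis {:V}) a (f x)).
Proof. exact: cinfvP. Qed.

(* The a-th component of f in the basis [vbasis fullv] of V. *)
Definition cinfv_coord (a : 'I_(\dim {:V})) (f : Cinfv) : Cinf M :=
  mk_cinf (smooth_coord f a).

Lemma cinfv_coordE (f : Cinfv) x :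
  f x = \sum_a cinfv_coord a f x *: (vbasis {:V})`_a.
Proof. by rewrite -coord_vbasis ?memvf. Qed.

End VectorValued.

(* Vector fields are the derivations of the algebra C^oo(M), and (below)      *)
(* differential forms are C^oo(M)-multilinear alternating maps on vector      *)
(* fields, as in Helgason's book.                                             *)
Section VectorFields.
Variables (R : realType) (n : nat) (M : manifold R n).

Definition derivation (D : Cinf M -> Cinf M) : Prop :=
  (forall (c : R) f g, D (cinf_cst M c * f + g) = cinf_cst M c * D f + D g) /\
  (forall f g, D (f * g) = D f * g + f * D g).

Definition derivation_pred : {pred Cinf M -> Cinf M} :=
  fun D => `[< derivation D >].

Record vfield := MkVfield {
  vfield_fun :> Cinf M -> Cinf M ; _ : vfield_fun \in derivation_pred }.

HB.instance Definition _ := [isSub for vfield_fun].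
HB.instance Definition _ := [Choice of vfield by <:].

Fact derivation_zmod_closed : zmod_closed derivation_pred.
Proof.
split; first by apply/asboolP; split=> *; rewrite !(mulr0, mul0r) addr0.
move=> X Y /asboolP[XZ XM] /asboolP[YZ YM]; apply/asboolP.
have E f : (X - Y) f = X f - Y f by [].
split.
  by move=> c f g; rewrite !E XZ YZ mulrBr opprD addrACA.
by move=> f g; rewrite !E XM YM mulrBl mulrBr opprD addrACA.
Qed.

HB.instance Definition _ :=
  GRing.SubChoice_isSubZmodule.Build _ _ vfield derivation_zmod_closed.

Lemma vfieldP (X : vfield) : derivation X.
Proof. by case: X => X /= /asboolP. Qed.

Definition mk_vfield D (dD : derivation D) : vfield := MkVfield (asboolT dD).

Fact derivation_scale (a : Cinf M) (X : vfield) :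
  derivation (fun f => a * X f).
Proof.
have [XZ XM] := vfieldP X; split=> [c f g|f g].
  by rewrite XZ mulrDr mulrCA.
by rewrite XM mulrDr mulrA mulrCA.
Qed.

Definition vfield_scale a X : vfield := mk_vfield (derivation_scale a X).

Fact vfield_scaleA a b X :
  vfield_scale a (vfield_scale b X) = vfield_scale (a * b) X.
Proof. by apply/val_inj/funext => f /=; rewrite mulrA. Qed.

Fact vfield_scale1 : left_id 1 vfield_scale.
Proof. by move=> X; apply/val_inj/funext => f /=; rewrite mul1r. Qed.

Fact vfield_scaleDr : right_distributive vfield_scale +%R.
Proof. by move=> a X Y; apply/val_inj/funext => f /=; rewrite mulrDr. Qed.

Fact vfield_scaleDl X : {morph vfield_scale^~ X : a b / a + b}.
Proof. by move=> a b; apply/val_inj/funext => f /=; rewrite mulrDl. Qed.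

HB.instance Definition _ := GRing.Zmodule_isLmodule.Build (Cinf M) vfield
  vfield_scaleA vfield_scale1 vfield_scaleDr vfield_scaleDl.

Fact vbracket_derivation (X Y : vfield) :
  derivation (fun f => X (Y f) - Y (X f)).
Proof.
have [XZ XM] := vfieldP X; have [YZ YM] := vfieldP Y.
have XD f g : X (f + g) = X f + X g.
  by have := XZ 1 f g; rewrite (_ : cinf_cst M 1 = 1) ?mul1r //; exact: val_inj.
have YD f g : Y (f + g) = Y f + Y g.
  by have := YZ 1 f g; rewrite (_ : cinf_cst M 1 = 1) ?mul1r //; exact: val_inj.
split=> [c f g|f g].
  by rewrite YZ XZ XZ YZ mulrBr opprD addrACA.
rewrite YM XM XD YD !XM !YM; ring.
Qed.

Definition vbracket X Y : vfield := mk_vfield (vbracket_derivation X Y).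

End VectorFields.

(* The value X_x of X at x, as a derivation at x. *)
Definition value_at (R : realType) (n : nat) (M : manifold R n)
  (X : vfield M) (x : M) : Cinf M -> R := fun f => X f x.

Section VectorCalculus.
Variables (R : realType) (n : nat) (M : manifold R n).

(* Derivative of a V-valued function along X, computed componentwise; the     *)
(* result does not depend on the basis.                                       *)
Definition vder (V : vectType R) (X : vfield M) (f : Cinfv M V) : Cinfv M V :=
  \sum_(a < \dim {:V}) X (cinfv_coord a f) *: cinfv_cst M (vbasis {:V})`_a.

Fact smooth_lie (g : lieAlgType R) (f h : Cinfv M g) :
  vsmooth (fun x => lie (f x) (h x)).
Proof.
move=> l.
have llin v : scalar (fun w => l (lie v w)).
  by move=> a u w; rewrite lie_linearr linearP.
pose lv v : {scalar g} := HB.pack (fun w => l (lie v w))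
  (GRing.isLinear.Build _ _ _ _ _ (llin v)).
have rlin w : linear (fun v : g => lie v w) by exact: lie_linearl.
have liel x : l (lie (f x) (h x)) =
    \sum_(a < \dim {:g}) cinfv_coord a f x * lv (vbasis {:g})`_a (h x).
  pose rw : {linear g -> g} := HB.pack (fun v : g => lie v (h x))
    (GRing.isLinear.Build _ _ _ _ _ (rlin (h x))).
  rewrite -[lie (f x) (h x)]/(rw (f x)) (cinfv_coordE f x) !linear_sum.
  by apply: eq_bigr => a _; rewrite !linearZ.
under eq_fun do rewrite liel.
apply: (smooth_sum _ (F := fun (a : 'I_(\dim {:g})) x =>
  cinfv_coord a f x * lv (vbasis {:g})`_a (h x))) => a.
exact: (smoothM (cinfP (cinfv_coord a f)) (cinfvP h (lv _))).
Qed.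

Definition cinfv_lie (g : lieAlgType R) (f h : Cinfv M g) : Cinfv M g :=
  mk_cinfv (smooth_lie f h).

End VectorCalculus.

(* A g-manifold: an infinitesimal action of g on M. *)
Record inf_action (R : realType) (n : nat) (g : lieAlgType R)
    (M : manifold R n) := InfAction {
  fundamental :> g -> vfield M ;
  fundamentalP : forall (c : R) X Y,
    fundamental (c *: X + Y) = cinf_cst M c *: fundamental X + fundamental Y ;
  fundamental_lie : forall X Y,
    fundamental (lie X Y) = vbracket (fundamental X) (fundamental Y)
}.

Section FundamentalFields.
Variables (R : realType) (n : nat) (g : lieAlgType R) (M : manifold R n).
Variable zeta : inf_action g M.

Lemma fundamental_coordE (u : Cinfv M g) (f : Cinf M) x :
  zeta (u x) f x =
  \sum_(a < \dim {:g}) cinfv_coord a u x * zeta (vbasis {:g})`_a f x.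
Proof.
have lin : scalar (fun X : g => zeta X f x).
  by move=> c X Y; rewrite fundamentalP.
pose l : {scalar g} := HB.pack (fun X : g => zeta X f x)
  (GRing.isLinear.Build _ _ _ _ _ lin).
rewrite -[LHS]/(l (u x)) (cinfv_coordE u x) linear_sum.
by apply: eq_bigr => a _; rewrite linearZ.
Qed.

Fact smooth_zeta (u : Cinfv M g) (f : Cinf M) :
  smooth (fun x => zeta (u x) f x).
Proof.
under eq_fun do rewrite fundamental_coordE.
apply: (smooth_sum _ (F := fun (a : 'I_(\dim {:g})) x =>
  cinfv_coord a u x * zeta (vbasis {:g})`_a f x)) => a.
exact: (smoothM (cinfP _) (cinfP _)).
Qed.

Fact derivation_zeta (u : Cinfv M g) :
  derivation (fun f => mk_cinf (smooth_zeta u f)).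
Proof.
split=> [c f h|f h]; apply/val_inj/funext => x /=.
  by have [-> _] := vfieldP (zeta (u x)).
by have [_ ->] := vfieldP (zeta (u x)).
Qed.

(* zeta_u for u in C^oo(M; g): (zeta_u)(x) = zeta_(u x)(x). *)
Definition zeta_vfield (u : Cinfv M g) : vfield M :=
  mk_vfield (derivation_zeta u).

Lemma value_at_zeta u x : value_at (zeta_vfield u) x = value_at (zeta (u x)) x.
Proof. by []. Qed.

End FundamentalFields.

(* A p-form with values in a C^oo(M)-module E is a C^oo(M)-multilinear        *)
(* alternating map from X(M)^p to E; E = C^oo(M), C^oo(M; V), X(M) give the   *)
(* scalar, V-valued and TM-valued forms.  Elements of [cochain M p E] are     *)
(* arbitrary maps, [is_form] singles out the forms.                           *)
Definition cochain (R : realType) (n : nat) (M : manifold R n) (p : nat)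
  (E : Type) := ('I_p -> vfield M) -> E.

Section Forms.
Variables (R : realType) (n : nat) (M : manifold R n).
Implicit Types (E F G : lmodType (Cinf M)) (p q : nat) (X : vfield M).

Definition is_form p E (alpha : cochain M p E) : Prop :=
  (forall (xi : 'I_p -> vfield M) i (f : Cinf M) X Y,
     alpha [eta xi with i |-> f *: X + Y] =
     f *: alpha [eta xi with i |-> X] + alpha [eta xi with i |-> Y]) /\
  (forall (xi : 'I_p -> vfield M) i j, i != j -> xi i = xi j -> alpha xi = 0).

(* Wedge product relative to a pairing m of the values. *)
Definition wedge E F G (m : E -> F -> G) p q (alpha : cochain M p E)
    (beta : cochain M q F) : cochain M (p + q) G := fun xi =>
  cinf_cst M (p`! * q`!)%:R^-1 *:
    \sum_(s : 'S_(p + q)) (-1) ^+ s *: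
       m (alpha (fun i => xi (s (lshift q i))))
         (beta (fun j => xi (s (rshift p j)))).

(* [act] is the action of vector fields on the values.                        *)
Definition lie_der E (act : vfield M -> E -> E) X p (alpha : cochain M p E) :
    cochain M p E := fun xi =>
  act X (alpha xi) -
  \sum_(i < p) alpha [eta xi with i |-> vbracket X (xi i)].

(* The usual formula                                                          *)
(*   sum_j (-1)^j xi_j . alpha(.., omit xi_j, ..)                             *)
(*   + sum_(i < j) (-1)^(i + j) alpha([xi_i, xi_j], .., omit xi_i, xi_j, ..)  *)
(* in which, in the second sum, [xi_i, xi_j] has been moved to the i-th slot, *)
(* at the cost of a sign (-1)^i.                                              *)
Definition extd E (act : vfield M -> E -> E) p (alpha : cochain M p E) :
    cochain M p.+1 E := fun xi =>
  \sum_(j < p.+1) (-1) ^+ j *: act (xi j) (alpha (fun k => xi (lift j k))) +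
  \sum_(j < p.+1) \sum_(i < p | (i < j)%N) (-1) ^+ j *:
    alpha [eta (fun k => xi (lift j k))
             with i |-> vbracket (xi (lift j i)) (xi j)].

Definition interior E X p : cochain M p E -> cochain M p.-1 E :=
  match p with
  | 0 => fun _ _ => 0
  | p'.+1 => fun alpha xi =>
      alpha (fun k : 'I_p'.+1 => if unlift ord0 k is Some j then xi j else X)
  end.

Definition sform p := cochain M p (Cinf M)^o.

Definition swedge p q : sform p -> sform q -> sform (p + q) :=
  @wedge (Cinf M)^o (Cinf M)^o (Cinf M)^o *%R p q.
Definition slie_der X p : sform p -> sform p :=
  @lie_der (Cinf M)^o (fun Y f => Y f) X p.
Definition sextd p : sform p -> sform p.+1 :=
  @extd (Cinf M)^o (fun Y f => Y f) p.

(* d alpha /\ i_X beta and i_X alpha /\ d beta, in degree k + l.              *)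
Definition extd_wedge_interior X k l :
    sform k -> sform l -> sform (k + l) :=
  match l with
  | 0 => fun _ _ _ => 0
  | l'.+1 => fun alpha beta xi =>
      swedge (sextd alpha) (interior X beta)
             (fun i => xi (cast_ord (addSnnS k l') i))
  end.

Definition interior_wedge_extd X k l :
    sform k -> sform l -> sform (k + l) :=
  match k with
  | 0 => fun _ _ _ => 0
  | k'.+1 => fun alpha beta xi =>
      swedge (interior X alpha) (sextd beta)
             (fun i => xi (cast_ord (esym (addSnnS k' l)) i))
  end.

Definition tensor p (alpha : sform p) X : cochain M p (vfield M) :=
  fun xi => (alpha xi : Cinf M) *: X.

(* K and L restrict to the same TM-valued form on U.                          *)
Definition agree_on p (U : set M) (K L : cochain M p (vfield M)) : Prop :=
  forall xi x, U x -> value_at (K xi) x = value_at (L xi) x.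

End Forms.

(* The Froelicher-Nijenhuis bracket, through the properties that determine it *)
(* on TM-valued forms (its values on other cochains are irrelevant).          *)
Record FN_bracket (R : realType) (n : nat) (M : manifold R n) := FNBracket {
  FN :> forall k l, cochain M k (vfield M) -> cochain M l (vfield M) ->
                    cochain M (k + l) (vfield M) ;
  FN_form : forall k l (K : cochain M k (vfield M)) (L : cochain M l (vfield M)),
    is_form K -> is_form L -> is_form (FN K L) ;
  FN_linearl : forall k l (c : R) (K K' : cochain M k (vfield M))
      (L : cochain M l (vfield M)),
    is_form K -> is_form K' -> is_form L ->
    FN (cinf_cst M c *: K + K') L = cinf_cst M c *: FN K L + FN K' L ;
  FN_linearr : forall k l (c : R) (K : cochain M k (vfield M))
      (L L' : cochain M l (vfield M)),
    is_form K -> is_form L -> is_form L' ->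
    FN K (cinf_cst M c *: L + L') = cinf_cst M c *: FN K L + FN K L' ;
  FN_local : forall k l (U : set M) (K K' : cochain M k (vfield M))
      (L L' : cochain M l (vfield M)),
    is_form K -> is_form K' -> is_form L -> is_form L' -> open U ->
    agree_on U K K' -> agree_on U L L' -> agree_on U (FN K L) (FN K' L') ;
  FN_tensor : forall k l (alpha : sform M k) (beta : sform M l)
      (X Y : vfield M),
    is_form alpha -> is_form beta ->
    FN (tensor alpha X) (tensor beta Y) =
      tensor (swedge alpha beta) (vbracket X Y)
      + tensor (swedge alpha (slie_der X beta)) Y
      - tensor (swedge (slie_der Y alpha) beta) X
      + (-1) ^+ k *: (tensor (extd_wedge_interior X alpha beta) Y
                      + tensor (interior_wedge_extd Y alpha beta) X)
}.

(* Linear over R and reversing brackets, between graded subspaces A of        *)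
(* [cochain M p E] and B of [cochain M p F], A being closed under its bracket. *)
Definition graded_Lie_antihom (R : realType) (n : nat) (M : manifold R n)
    (E F : lmodType (Cinf M))
    (A : forall p, cochain M p E -> Prop) (B : forall p, cochain M p F -> Prop)
    (brA : forall p q, cochain M p E -> cochain M q E -> cochain M (p + q) E)
    (brB : forall p q, cochain M p F -> cochain M q F -> cochain M (p + q) F)
    (h : forall p, cochain M p E -> cochain M p F) : Prop :=
  [/\ forall p (c : R) (a a' : cochain M p E), A p a -> A p a' ->
        A p (cinf_cst M c *: a + a') /\
        h p (cinf_cst M c *: a + a') = cinf_cst M c *: h p a + h p a',
      forall p a, A p a -> B p (h p a),
      forall p q a b, A p a -> A q b -> A (p + q)%N (brA p q a b) &
      forall p q a b, A p a -> A q b ->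
        brB p q (h p a) (h q b) = - h (p + q)%N (brA p q a b)].

Section GManifold.
Variables (R : realType) (n : nat) (g : lieAlgType R) (M : manifold R n).
Variable zeta : inf_action g M.

Definition gform p := cochain M p (Cinfv M g).

Definition horizontal (E : lmodType (Cinf M)) p (alpha : cochain M p E) :=
  forall X : g, interior (zeta X) alpha = 0.

Definition equivariant p (phi : gform p) : Prop := forall X : g,
  lie_der (@vder _ _ M g) (zeta X) phi =
  fun xi => - cinfv_lie (cinfv_cst M X) (phi xi).

Definition invariant_gform p (phi : gform p) : Prop :=
  is_form phi /\ equivariant phi.

Definition hor_invariant_gform p (phi : gform p) : Prop :=
  invariant_gform phi /\ horizontal phi.

Definition gform_bracket p q : gform p -> gform q -> gform (p + q) :=
  @wedge _ _ M _ _ _ (@cinfv_lie _ _ M g) p q.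

Definition gextd p : gform p -> gform p.+1 :=
  @extd _ _ M _ (@vder _ _ M g) p.

Definition zeta_form p (phi : gform p) : cochain M p (vfield M) :=
  fun xi => zeta_vfield zeta (phi xi).

(* omega_x (zeta_x X) is the value at x of the function omega (zeta X).       *)
Definition principal_connection_form (omega : gform 1) : Prop :=
  invariant_gform omega /\
  forall (x : M) (X : g),
    value_at (zeta (omega (fun=> zeta X) x)) x = value_at (zeta X) x.

End GManifold.

Definition vform0 (R : realType) (n : nat) (M : manifold R n) (X : vfield M) :
  cochain M 0 (vfield M) := fun=> X.

(* Main.v *)
Require Import Defs.
From HB Require Import structures.
From mathcomp Require Import all_boot all_order all_algebra.
From mathcomp Require Import fingroup perm.
From mathcomp Require Import boolp classical_sets functions reals.
From mathcomp Require Import topology normedtype derive.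

Set Implicit Arguments.
Unset Strict Implicit.
Unset Printing Implicit Defensive.

Import GRing.Theory.
Local Open Scope ring_scope.

(** Over a basis [e_a] of the Lie algebra, a form [phi] with values in it is the
    global sum of its scalar coordinates, [phi = sum_a phi^a (x) e_a], hence
    [zeta_phi = sum_a phi^a (x) zeta_(e_a)].  Bilinearity and the formula for
    decomposable forms therefore compute the Froelicher-Nijenhuis bracket of
    two such forms.

    The formula has five terms.  The first one, [phi^a /\ psi^b (x)
    [zeta_a, zeta_b]], adds up to [zeta_[phi, psi]].  Equivariance replaces
    [L_(zeta_a) psi] by [- [e_a, psi]] in the second one and
    [L_(zeta_b) phi] by [- [e_b, phi]] in the third one, and each of these two
    adds up to [- zeta_[phi, psi]].  So the three terms together give
    [- zeta_[phi, psi]]; this is [FN_zeta_form].  The remaining two terms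
    contain a contraction of [phi] or [psi] with a fundamental field: they
    vanish for horizontal forms, so [zeta] reverses brackets.  For a
    connection form [omega] the contraction [i_(zeta_b) omega] is a function,
    and [zeta o omega o zeta = zeta] collapses the sum over [a]
    ([zeta_connection]): each surviving term is then [- zeta_(d psi)].  There
    is one of them when [psi] is horizontal and there are two when [psi] is
    [omega] itself, whence the factor 1/2 in the formula for the curvature.

    The Lie derivative of [zeta_psi] along [zeta_X] is
    [zeta_(L_(zeta_X) psi + [X, psi]) = 0] ([vbracket_zeta_vfield]), and the
    bracket formula with [1 (x) zeta_X] as first argument has the same two
    terms.

    Two facts about forms as multilinear maps on vector fields are needed.
    The wedge product of two alternating multilinear maps is again one and the
    Lie derivative is a derivation of it, so that the invariant horizontal
    forms are closed under the bracket.  And wedging a function with [d psi]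
    has to be plain multiplication, although the wedge product antisymmetrizes:
    this requires [d psi] to be skew, which is proved by induction on the
    degree through Cartan's formula ([cartan], [extd_skew]). *)

(** * Constants, vector fields and coordinates as linear objects *)

Section LinearObjects.
Variables (R : realType) (n : nat) (M : manifold R n).
Implicit Types (X Y : vfield M) (f h : Cinf M).

Fact cinf_cst_zmod_morphism : zmod_morphism (cinf_cst M).
Proof. by move=> a b; exact: val_inj. Qed.

Fact cinf_cst_monoid_morphism : monoid_morphism (cinf_cst M).
Proof. by split=> [|a b]; exact: val_inj. Qed.

HB.instance Definition _ := GRing.isZmodMorphism.Build R (Cinf M)
  (cinf_cst M) cinf_cst_zmod_morphism.
HB.instance Definition _ := GRing.isMonoidMorphism.Build R (Cinf M)
  (cinf_cst M) cinf_cst_monoid_morphism.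

Lemma cinf_cstVK (E : lmodType (Cinf M)) (k : nat) (e : E) :
  (0 < k)%N -> cinf_cst M k%:R^-1 *: (e *+ k) = e.
Proof.
move=> k0; rewrite -scaler_nat scalerA -(rmorph_nat (cinf_cst M)) -rmorphM.
by rewrite mulVf ?rmorph1 ?scale1r // Num.Theory.pnatr_eq0 -lt0n.
Qed.

Lemma cinf_oppr_eq0 (E : lmodType (Cinf M)) (e : E) : e = - e -> e = 0.
Proof.
move=> eN; rewrite -(cinf_cstVK e (isT : (0 < 2)%N)).
by rewrite (_ : e *+ 2 = 0) ?scaler0 // mulr2n {1}eN addNr.
Qed.

Fact vfield_zmod_morphism X : zmod_morphism X.
Proof.
have [XZ _] := vfieldP X => f h.
by rewrite addrC -mulN1r -(rmorph1 (cinf_cst M)) -rmorphN XZ rmorphN rmorph1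
  mulN1r addrC.
Qed.

HB.instance Definition _ X := GRing.isZmodMorphism.Build (Cinf M) (Cinf M)
  X (vfield_zmod_morphism X).

Lemma vfieldM X f h : X (f * h) = X f * h + f * X h.
Proof. by case: (vfieldP X). Qed.

Lemma vfield_cst X c : X (cinf_cst M c) = 0.
Proof.
have X1 : X 1 = 0.
  have := vfieldM X 1 1; rewrite !mul1r mulr1 => e.
  by apply: (addrI (X 1)); rewrite addr0.
have [XZ _] := vfieldP X.
by have := XZ c 1 0; rewrite raddf0 X1 mulr0 mulr1 !addr0.
Qed.

Lemma vbracketC X Y : vbracket X Y = - vbracket Y X.
Proof. by apply/val_inj/funext => f /=; rewrite opprB. Qed.

Lemma vbracketZr X f Y : vbracket X (f *: Y) = X f *: Y + f *: vbracket X Y.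
Proof.
apply/val_inj/funext => h; apply/val_inj/funext => x /=.
by rewrite vfieldM /= mulrBr addrA.
Qed.

Fact vbracket_zmod_morphism X : zmod_morphism (vbracket X).
Proof.
move=> Y Z; apply/val_inj/funext => f /=.
by rewrite raddfB opprD addrACA -opprD.
Qed.

HB.instance Definition _ X := GRing.isZmodMorphism.Build (vfield M) (vfield M)
  (vbracket X) (vbracket_zmod_morphism X).

Section Coordinates.
Variable V : vectType R.
Implicit Types u v : Cinfv M V.
Local Notation e_ a := ((vbasis {:V})`_a : V).

Fact cinfv_coord_linear a :
  linear (@cinfv_coord R n M V a : Cinfv M V -> (Cinf M)^o).
Proof. by move=> f u v; apply/val_inj/funext => x /=; rewrite linearP. Qed.

HB.instance Definition _ a := GRing.isLinear.Build (Cinf M) (Cinfv M V)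
  (Cinf M)^o *:%R (@cinfv_coord R n M V a) (cinfv_coord_linear a).

Lemma cinfv_sum I (r : seq I) (P : pred I) (F : I -> Cinfv M V) x :
  (\sum_(i <- r | P i) F i) x = \sum_(i <- r | P i) F i x.
Proof. by elim/big_rec2: _ => // i y z _ <-. Qed.

Lemma cinfv_decomp u : u = \sum_a cinfv_coord a u *: cinfv_cst M (e_ a).
Proof.
apply/val_inj/funext => x; rewrite [RHS]cinfv_sum; exact: cinfv_coordE.
Qed.

Lemma cinfv_coord_cst (a b : 'I_(\dim {:V})) :
  cinfv_coord a (cinfv_cst M (e_ b)) = (a == b)%:R.
Proof.
apply/val_inj/funext => x /=; rewrite coord_free ?(basis_free (vbasisP _)) //.
by case: eqVneq.
Qed.

(** [vder] is defined through the basis, so coordinates commute with it. *)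
Lemma cinfv_coord_vder a X u : cinfv_coord a (vder X u) = X (cinfv_coord a u).
Proof.
rewrite /vder (raddf_sum (cinfv_coord a)) (bigD1 a) //= big1 ?addr0.
  by rewrite linearZ /= cinfv_coord_cst eqxx /= /GRing.scale /= mulr1.
move=> b ba; rewrite linearZ /= cinfv_coord_cst eq_sym (negbTE ba).
by rewrite /GRing.scale /= mulr0.
Qed.

Lemma cinfv_coord_inj u v :
  (forall a, cinfv_coord a u = cinfv_coord a v) -> u = v.
Proof.
by move=> uv; rewrite (cinfv_decomp u) (cinfv_decomp v); under eq_bigr do rewrite uv.
Qed.

Fact vder_zmod_morphism X : zmod_morphism (@vder R n M V X).
Proof.
move=> u v; apply: cinfv_coord_inj => a.
rewrite (raddfB (cinfv_coord a)) /= !cinfv_coord_vder.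
by rewrite (raddfB (cinfv_coord a)) raddfB.
Qed.

HB.instance Definition _ X := GRing.isZmodMorphism.Build
  (Cinfv M V) (Cinfv M V) (vder X) (vder_zmod_morphism X).

Lemma vderZ X f u : vder X (f *: u) = X f *: u + f *: vder X u.
Proof.
apply: cinfv_coord_inj => a.
rewrite (raddfD (cinfv_coord a)) /= cinfv_coord_vder !linearZ /=.
by rewrite cinfv_coord_vder /GRing.scale /= vfieldM.
Qed.

Lemma vder_cstZ X c u : vder X (cinf_cst M c *: u) = cinf_cst M c *: vder X u.
Proof. by rewrite vderZ vfield_cst scale0r add0r. Qed.

Lemma vder_cst X (v : V) : vder X (cinfv_cst M v) = 0.
Proof.
apply: cinfv_coord_inj => a; rewrite cinfv_coord_vder raddf0.
by rewrite -(vfield_cst X (coord (vbasis {:V}) a v)); congr (X _); exact: val_inj.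
Qed.

End Coordinates.

Section LieValued.
Variable g : lieAlgType R.
Implicit Types u v w : Cinfv M g.

Lemma cinfv_lie_linearl v : linear ((@cinfv_lie R n M g)^~ v).
Proof. by move=> f u w; apply/val_inj/funext => x /=; exact: lie_linearl. Qed.

Lemma cinfv_lie_linearr u : linear (@cinfv_lie R n M g u).
Proof. by move=> f v w; apply/val_inj/funext => x /=; exact: lie_linearr. Qed.

HB.instance Definition _ u := GRing.isLinear.Build (Cinf M) (Cinfv M g)
  (Cinfv M g) *:%R (cinfv_lie u) (cinfv_lie_linearr u).

Lemma cinfv_lieC u v : cinfv_lie u v = - cinfv_lie v u.
Proof.
apply/val_inj/funext => x /=.
have lD (a b c : g) : lie (a + b) c = lie a c + lie b c.
  by have := lie_linearl c 1 a b; rewrite !scale1r.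
have rD (a b c : g) : lie c (a + b) = lie c a + lie c b.
  by have := lie_linearr c 1 a b; rewrite !scale1r.
apply/eqP; rewrite -addr_eq0; apply/eqP.
by have := liexx (u x + v x); rewrite lD !rD !liexx add0r addr0.
Qed.

Lemma cinfv_lie_jacobi u v w :
  cinfv_lie u (cinfv_lie v w) =
  cinfv_lie (cinfv_lie u v) w + cinfv_lie v (cinfv_lie u w).
Proof.
rewrite [cinfv_lie (cinfv_lie u v) w]cinfv_lieC (cinfv_lieC u w) raddfN -opprD.
apply/eqP; rewrite -addr_eq0 [X in _ + X]addrC addrA; apply/eqP.
by apply/val_inj/funext => x; exact: lie_jacobi.
Qed.

(** Structure constants: this reduces the Leibniz rule [vder_lie] to the one
    for products of functions. *)
Lemma cinfv_lieE u v : cinfv_lie u v =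
  \sum_a \sum_b (cinfv_coord a u * cinfv_coord b v) *:
    cinfv_cst M (lie (vbasis {:g})`_a (vbasis {:g})`_b).
Proof.
rewrite {1}(cinfv_decomp v) raddf_sum exchange_big /=; apply: eq_bigr => b _.
rewrite linearZ /= cinfv_lieC {1}(cinfv_decomp u) raddf_sum -sumrN scaler_sumr.
apply: eq_bigr => a _; rewrite /= linearZ /= -scalerN -cinfv_lieC scalerA mulrC.
by congr (_ *: _); exact: val_inj.
Qed.

Lemma vder_lie X u v :
  vder X (cinfv_lie u v) = cinfv_lie (vder X u) v + cinfv_lie u (vder X v).
Proof.
rewrite !cinfv_lieE raddf_sum -big_split; apply: eq_bigr => a _ /=.
rewrite raddf_sum -big_split; apply: eq_bigr => b _ /=.
by rewrite vderZ vder_cst scaler0 addr0 vfieldM scalerDl !cinfv_coord_vder.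
Qed.

End LieValued.

End LinearObjects.

(** * Alternating forms as skew functions of tuples of vector fields *)

Section AlternatingForms.
Variables (R : realType) (n : nat) (M : manifold R n).
Implicit Types (E F G : lmodType (Cinf M)) (X Y Z : vfield M).

(** The characterization of alternation by which sums over permutations are
    handled; it is equivalent to vanishing on repeated entries because 2 is
    invertible among the functions. *)
Definition skew_cochain p E (alpha : cochain M p E) : Prop :=
  forall (s : 'S_p) xi, alpha (fun i => xi (s i)) = (-1) ^+ s *: alpha xi.

Lemma skew_tperm p E (alpha : cochain M p E) :
  (forall i j xi, i != j -> alpha (fun k => xi (tperm i j k)) = - alpha xi) ->
  skew_cochain alpha.
Proof.
move=> alphaN s; have [ts -> dts] := prod_tpermP s.
rewrite odd_perm_prod // => {s}; elim: ts dts => [_|[i j] ts IH /andP[ij dts]] xi.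
  rewrite big_nil scale1r; congr alpha; apply/funext => k.
  by rewrite perm1.
rewrite big_cons /=; set s := (\prod_(t <- ts) _)%g in IH *.
transitivity (alpha (fun k => (fun l => xi (s l)) (tperm i j k))).
  by congr alpha; apply/funext => k; rewrite permM.
rewrite (alphaN _ _ (fun l => xi (s l))) // IH // -scaleNr; congr (_ *: _).
by case: (odd _) => /=; rewrite ?expr1 ?expr0 ?opprK.
Qed.

(** Polarization: expand the value at a tuple with the sum [xi i + xi j] in
    both slots. *)
Lemma form_skew p E (alpha : cochain M p E) : is_form alpha -> skew_cochain alpha.
Proof.
move=> [lin alt]; apply: skew_tperm => i j xi ij.
have aD (eta : 'I_p -> vfield M) k X Y :
    alpha [eta eta with k |-> X + Y] =
    alpha [eta eta with k |-> X] + alpha [eta eta with k |-> Y].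
  by have := lin eta k 1 X Y; rewrite !scale1r.
pose h X Y : 'I_p -> vfield M := [eta [eta xi with i |-> X] with j |-> Y].
have hE X Y : h X Y = [eta [eta xi with j |-> Y] with i |-> X].
  apply/funext => k; rewrite /h /=; case: (eqVneq k j) => [->|//].
  by rewrite eq_sym (negbTE ij).
have hDl X X' Y : alpha (h (X + X') Y) = alpha (h X Y) + alpha (h X' Y).
  by rewrite !hE aD.
have hDr X Y Y' : alpha (h X (Y + Y')) = alpha (h X Y) + alpha (h X Y').
  by rewrite /h aD.
have h0 X : alpha (h X X) = 0.
  by apply: (alt _ i j) => //; rewrite /h /= !eqxx if_same.
have -> : (fun k => xi (tperm i j k)) = h (xi j) (xi i).
  apply/funext => k; rewrite /h /=; case: tpermP => [->|->|].
  - by rewrite eqxx (negbTE ij).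
  - by rewrite eqxx.
  - by move=> /eqP/negbTE -> /eqP/negbTE ->.
have -> : alpha xi = alpha (h (xi i) (xi j)).
  congr alpha; apply/funext => k; rewrite /h /=.
  by case: eqP => [->|_] //; case: eqP => [->|].
apply/eqP; rewrite -addr_eq0; apply/eqP.
by have := h0 (xi i + xi j); rewrite hDl !hDr !h0 add0r addr0 addrC.
Qed.

(** Exchanging two equal entries changes the sign, and 2 is invertible. *)
Lemma is_formP p E (alpha : cochain M p E) :
  (forall (xi : 'I_p -> vfield M) i (f : Cinf M) X Y,
     alpha [eta xi with i |-> f *: X + Y] =
     f *: alpha [eta xi with i |-> X] + alpha [eta xi with i |-> Y]) ->
  skew_cochain alpha -> is_form alpha.
Proof.
move=> lin sk; split=> // xi i j ij xij; apply: cinf_oppr_eq0.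
have := sk (tperm i j) xi; rewrite odd_tperm ij expr1 scaleN1r => <-.
by congr alpha; apply/funext => k; case: tpermP => [->|->|].
Qed.

Lemma form_comp p E F (h : {linear E -> F}) (alpha : cochain M p E) :
  is_form alpha -> is_form (fun xi => h (alpha xi)).
Proof.
move=> [lin alt]; split=> [xi i f X Y|xi i j ij xij].
  by rewrite lin linearP.
by rewrite (alt _ _ _ ij xij) linear0.
Qed.

Lemma formP p E (c : Cinf M) (alpha beta : cochain M p E) :
  is_form alpha -> is_form beta -> is_form (c *: alpha + beta).
Proof.
move=> [la aa] [lb ab]; split=> [xi i f X Y|xi i j ij xij].
  rewrite !fctE la lb !scalerDr addrACA; congr (_ + _).
  by congr (_ + _); rewrite !scalerA mulrC.
by rewrite !fctE (aa _ _ _ ij xij) (ab _ _ _ ij xij) scaler0 addr0.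
Qed.

Lemma form0 p E : is_form (0 : cochain M p E).
Proof.
split=> [xi i f X Y|//].
by rewrite -[LHS]/(0 : E) -[RHS]/(f *: 0 + 0 : E) scaler0 addr0.
Qed.

Lemma form_sum p E I (r : seq I) (alpha : I -> cochain M p E) :
  (forall i, is_form (alpha i)) -> is_form (\sum_(i <- r) alpha i).
Proof.
move=> ha; elim: r => [|i r IH]; first by rewrite big_nil; exact: form0.
by rewrite big_cons -[X in X + _]scale1r; exact: formP.
Qed.

(** Moving the first entry to place [j] is a cycle of sign [(-1) ^ j]. *)
Lemma skew_slot p E (alpha : cochain M p.+1 E) : skew_cochain alpha ->
  forall j (xi : 'I_p.+1 -> vfield M) Z,
  alpha (fun k => if unlift ord0 k is Some i then xi (lift j i) else Z) =
  (-1) ^+ j *: alpha [eta xi with j |-> Z].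
Proof.
move=> sk j xi Z; have := sk (lift_perm ord0 j 1%g) [eta xi with j |-> Z].
rewrite odd_lift_perm odd_perm1 /= addbF => sE.
rewrite -[in RHS]signr_odd -sE; congr alpha; apply/funext => k.
case: unliftP => [i ->|->]; last by rewrite lift_perm_id eqxx.
by rewrite lift_perm_lift perm1 eq_sym (negbTE (neq_lift _ _)).
Qed.

End AlternatingForms.

(** * Cartan's formula and the skew symmetry of the exterior derivative *)

Section Cartan.
Variables (R : realType) (n : nat) (M : manifold R n).
Variables (E : lmodType (Cinf M)) (act : vfield M -> E -> E).
Hypothesis actN : forall X e, act X (- e) = - act X e.
Implicit Types (X Y Z : vfield M).

(** The tuple that [interior] evaluates a form at. *)
Definition vcons p X (xi : 'I_p -> vfield M) : 'I_p.+1 -> vfield M :=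
  fun k => if unlift ord0 k is Some j then xi j else X.

Lemma vcons0 p X (xi : 'I_p -> vfield M) : vcons X xi ord0 = X.
Proof. by rewrite /vcons unlift_none. Qed.

Lemma vconsS p X (xi : 'I_p -> vfield M) k : vcons X xi (lift ord0 k) = xi k.
Proof. by rewrite /vcons liftK. Qed.

Lemma vcons_eta p (xi : 'I_p.+1 -> vfield M) :
  xi = vcons (xi ord0) (fun k => xi (lift ord0 k)).
Proof.
by apply/funext => k; case: (unliftP ord0 k) => [i|] ->; rewrite ?vconsS ?vcons0.
Qed.

Lemma vcons_with0 p X Y (xi : 'I_p -> vfield M) :
  [eta vcons X xi with ord0 |-> Y] = vcons Y xi :> ('I_p.+1 -> vfield M).
Proof.
apply/funext => k; case: (unliftP ord0 k) => [i|] -> /=.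
  by rewrite !vconsS.
by rewrite vcons0.
Qed.

Lemma vcons_withS p X Y (xi : 'I_p -> vfield M) i :
  [eta vcons X xi with lift ord0 i |-> Y] = vcons X [eta xi with i |-> Y]
  :> ('I_p.+1 -> vfield M).
Proof.
apply/funext => k; case: (unliftP ord0 k) => [j|] -> /=.
  by rewrite !vconsS (inj_eq lift_inj).
by rewrite !vcons0.
Qed.

Lemma lift0_lift0 p (j : 'I_p.+1) (i : 'I_p) :
  lift (lift ord0 j) (lift ord0 i) = lift ord0 (lift j i).
Proof. by apply: val_inj; rewrite /= bumpS. Qed.

Lemma vcons_lift p X (xi : 'I_p.+1 -> vfield M) j :
  (fun k => vcons X xi (lift (lift ord0 j) k)) =
  vcons X (fun k => xi (lift j k)).
Proof.
apply/funext => k; case: (unliftP ord0 k) => [i|] ->; rewrite ?vconsS ?vcons0.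
  by rewrite lift0_lift0 vconsS.
by rewrite (_ : lift _ _ = ord0) ?vcons0 //; apply: val_inj.
Qed.

Lemma interior_form p X (alpha : cochain M p.+1 E) :
  is_form alpha -> is_form (Defs.interior X alpha).
Proof.
move=> fa; have [lin _] := fa.
apply: is_formP => [xi i f Y Z|]; first by rewrite /= -!/(vcons _ _) -!vcons_withS lin.
move=> s xi; have := form_skew fa (lift_perm ord0 ord0 s) (vcons X xi).
rewrite odd_lift_perm /= => <-; congr alpha; apply/funext => k.
case: unliftP => [i|] ->; first by rewrite lift_perm_lift -/(vcons _ _) vconsS.
by rewrite lift_perm_id -/(vcons _ _) vcons0.
Qed.

(** [i_X d = L_X - d i_X].  In the sum that defines [d], the terms in which
    [X] is the omitted or a bracketed entry form [L_X alpha], up to moving the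
    bracket to the slot of its other entry; the others form [- d i_X alpha]. *)
Lemma cartan p X (alpha : cochain M p.+1 E) (xi : 'I_p.+1 -> vfield M) :
  skew_cochain alpha ->
  extd act alpha (vcons X xi) =
  lie_der act X alpha xi - extd act (Defs.interior X alpha) xi.
Proof.
move=> sk; rewrite /extd /lie_der big_ord_recl expr0 scale1r vcons0.
rewrite [X in _ + X]big_ord_recl [X in _ + (X + _)]big_pred0 // add0r.
rewrite opprD -!addrA; congr (_ + _).
  by congr (act _ (alpha _)); apply/funext => k; rewrite vconsS.
rewrite [RHS]addrCA; congr (_ + _).
  rewrite -sumrN; apply: eq_bigr => j _.
  by rewrite vconsS vcons_lift /= /bump /= add1n exprS mulN1r scaleNr.
rewrite -!sumrN -big_split; apply: eq_bigr => j _ /=.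
rewrite big_mkcond big_ord_recl /= vcons_lift -sumrN; congr (_ + _).
  rewrite vcons_with0 vconsS (_ : lift (lift ord0 j) ord0 = ord0); last exact: val_inj.
  rewrite vcons0 /vcons skew_slot // scalerA /bump /= add1n exprS mulN1r mulNr.
  by rewrite -expr2 sqrr_sign scaleN1r.
rewrite [RHS]big_mkcond; apply: eq_bigr => i _.
rewrite /= /bump /= !add1n ltnS; case: ifP => // _.
rewrite vcons_withS exprS mulN1r scaleNr -/(vcons _ _) vconsS.
by rewrite lift0_lift0 vconsS.
Qed.

Lemma lie_der_skew p X (alpha : cochain M p E) :
  skew_cochain alpha -> skew_cochain (lie_der act X alpha).
Proof.
have act_sign Y b e : act Y ((-1) ^+ (b : bool) *: e) = (-1) ^+ b *: act Y e.
  by case: b; rewrite ?expr1 ?expr0 ?scaleN1r ?scale1r.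
move=> sk s xi; rewrite /lie_der sk act_sign scalerBr; congr (_ - _).
rewrite scaler_sumr [RHS](reindex_inj (@perm_inj _ s)) /=.
apply: eq_bigr => i _; rewrite -sk; congr alpha; apply/funext => k /=.
by rewrite (inj_eq perm_inj).
Qed.

Lemma extdN p (alpha : cochain M p E) : extd act (- alpha) = - extd act alpha.
Proof.
apply/funext => xi; rewrite /extd -[RHS]/(- (extd act alpha xi)) opprD -!sumrN.
congr (_ + _); apply: eq_bigr => j _.
  by rewrite -scalerN -actN.
by rewrite -sumrN; apply: eq_bigr => i _; rewrite -scalerN.
Qed.

(** The permutations fixing 0 and the transposition (0 1) generate the
    symmetric group: they give every transposition (0 j) by conjugation. *)
Lemma skew_vcons p (D : cochain M p.+2 E) :
  (forall X, skew_cochain (fun xi => D (vcons X xi))) ->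
  (forall X Y xi, D (vcons X (vcons Y xi)) = - D (vcons Y (vcons X xi))) ->
  skew_cochain D.
Proof.
move=> tail swap.
have tailE (s : 'S_p.+1) xi :
    D (fun k => xi (lift_perm ord0 ord0 s k)) = (-1) ^+ s *: D xi.
  rewrite [in RHS](vcons_eta xi) -tail; congr D.
  rewrite [LHS]vcons_eta lift_perm_id; congr vcons.
  by apply/funext => k; rewrite lift_perm_lift.
have swapE xi : D (fun k => xi (tperm ord0 (lift ord0 ord0) k)) = - D xi.
  rewrite [in RHS](vcons_eta xi) [X in vcons _ X]vcons_eta swap opprK; congr D.
  rewrite [LHS]vcons_eta tpermL [X in vcons _ X]vcons_eta tpermR.
  by congr vcons; congr vcons; apply/funext => k; rewrite tpermD.
have head j xi : D (fun k => xi (tperm ord0 (lift ord0 j) k)) = - D xi.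
  pose s : 'S_p.+1 := tperm ord0 j; pose t := lift_perm ord0 ord0 s.
  have -> : tperm ord0 (lift ord0 j) =
      (t^-1 * (tperm ord0 (lift ord0 ord0) * t))%g.
    by rewrite -[RHS]/(_ ^ t)%g tpermJ lift_perm_id lift_perm_lift tpermL.
  transitivity (D (fun k => (fun l => xi (t (tperm ord0 (lift ord0 ord0) l)))
      (lift_perm ord0 ord0 s^-1%g k))).
    by congr D; apply/funext => k; rewrite !permM lift_permV.
  rewrite (tailE _ (fun l => xi (t (tperm ord0 (lift ord0 ord0) l)))).
  rewrite (swapE (fun l => xi (t l))) tailE odd_permV scalerN scalerA.
  by rewrite -expr2 sqrr_sign scale1r.
apply: skew_tperm => i j xi.
case: (unliftP ord0 i) => [i' ->|->]; case: (unliftP ord0 j) => [j' ->|->].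
- rewrite (inj_eq lift_inj) => ij.
  have := tailE (tperm i' j') xi; rewrite odd_tperm ij expr1 scaleN1r => <-.
  congr D; apply/funext => k; congr (xi _).
  case: (unliftP ord0 k) => [k' ->|->].
    by rewrite lift_perm_lift (inj_tperm _ _ _ lift_inj).
  by rewrite lift_perm_id tpermD // eq_sym neq_lift.
- by rewrite tpermC.
- by [].
- by rewrite eqxx.
Qed.

(** Cartan's formula reduces permutations of the tail to [L_X alpha] and
    [d i_X alpha], known by induction.  For the exchange of the first two entries
    it is applied twice: [d alpha (X, Y, ...)] is
    [L_X i_Y alpha - L_Y i_X alpha - i_[X, Y] alpha + d i_Y i_X alpha],
    which is antisymmetric in [X] and [Y]. *)
Lemma extd_skew p (alpha : cochain M p E) :
  is_form alpha -> skew_cochain (extd act alpha).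
Proof.
elim: p alpha => [alpha _ s xi|p IH alpha fa].
  rewrite (_ : s = 1%g) ?odd_perm1 ?scale1r.
    by congr extd; apply/funext => k; rewrite perm1.
  by apply/permP => k; rewrite !ord1.
have sk := form_skew fa; have [lin _] := fa.
apply: skew_vcons => [X s xi|X Y xi].
  by rewrite !cartan // lie_der_skew // IH ?scalerBr //; exact: interior_form.
(* i_W L_Z = L_Z i_W - i_[Z, W] *)
have comm Z W (eta : 'I_p -> vfield M) : lie_der act Z alpha (vcons W eta) =
    lie_der act Z (Defs.interior W alpha) eta
    - alpha (vcons (vbracket Z W) eta).
  rewrite /lie_der big_ord_recl opprD addrA addrAC; congr (_ - _ - _).
    apply: eq_bigr => i _; rewrite vcons_withS vconsS //.
  by rewrite vcons_with0 vcons0.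
have brC : alpha (vcons (vbracket Y X) xi) = - alpha (vcons (vbracket X Y) xi).
  have a0 : alpha (vcons 0 xi) = 0.
    have := lin (vcons X xi) ord0 (-1) 0 0.
    by rewrite !vcons_with0 scaleN1r addNr scaleN1r addNr.
  have := lin (vcons X xi) ord0 (-1) (vbracket X Y) 0.
  by rewrite !vcons_with0 a0 !addr0 !scaleN1r -vbracketC.
(* rho Z W is d i_W i_Z alpha, which makes sense only in degree at least 2;
   in degree 1 Cartan's formula for the function i_Z alpha has no such term. *)
have [rho rhoE rhoC] : exists2 rho : vfield M -> vfield M -> E,
    (forall Z W, extd act (Defs.interior Z alpha) (vcons W xi) =
       lie_der act W (Defs.interior Z alpha) xi - rho Z W)
    & forall Z W, rho Z W = - rho W Z.
  clear IH comm brC lin; case: p alpha fa xi sk => [|p] alpha fa xi sk.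
    exists (fun _ _ => 0) => [Z W|Z W]; last by rewrite oppr0.
    rewrite /extd /lie_der /= !big_ord1 !big_ord0.
    rewrite !subr0 addr0 expr0 scale1r vcons0; congr (act _ (alpha _)).
    by apply/funext => k; case: unliftP => [[]|].
  exists (fun Z W => extd act (Defs.interior W (Defs.interior Z alpha)) xi) => Z W.
    by rewrite cartan //; apply/form_skew/interior_form.
  rewrite (_ : Defs.interior W _ = - Defs.interior Z (Defs.interior W alpha)).
    by rewrite extdN.
  apply/funext => eta; rewrite -[RHS]/(- alpha (vcons W (vcons Z eta))).
  have := sk (tperm ord0 (lift ord0 ord0)) (vcons W (vcons Z eta)).
  rewrite odd_tperm neq_lift expr1 scaleN1r => <-.
  rewrite -[LHS]/(alpha (vcons Z (vcons W eta))); congr alpha.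
  rewrite [RHS]vcons_eta tpermL [X in _ = vcons _ X]vcons_eta tpermR vconsS !vcons0.
  by do 2!congr vcons; apply/funext => k; rewrite tpermD ?vconsS.
rewrite !cartan // !comm !rhoE brC (rhoC Y).
move: (lie_der act X _ xi) (lie_der act Y _ xi) => LX LY.
by rewrite !opprD !opprK addrACA [RHS]addrACA [LX - _]addrC.
Qed.

End Cartan.

(** * Wedge products relative to a pairing of the values *)

Section Wedge.
Variables (R : realType) (n : nat) (M : manifold R n).
Implicit Types (X Y Z : vfield M).

(** Skew symmetry moves the contracted slot to any position. *)
Lemma interior_eq0P (E : lmodType (Cinf M)) p X (alpha : cochain M p E) :
  skew_cochain alpha ->
  Defs.interior X alpha = 0 <-> (forall i xi, xi i = X -> alpha xi = 0).
Proof.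
case: p alpha => [|p] alpha sk; first by split=> // _ [].
split=> [a0 i xi xiX|a0]; last first.
  by apply/funext => xi; apply: (a0 ord0); rewrite unlift_none.
have := skew_slot sk i xi X.
rewrite -[LHS]/(Defs.interior X alpha (fun k => xi (lift i k))) a0.
rewrite (_ : [eta xi with i |-> X] = xi :> ('I_p.+1 -> vfield M)).
  by move/esym/(congr1 ( *:%R ((-1) ^+ i))); rewrite scalerA -expr2 sqrr_sign
    scale1r scaler0.
by apply/funext => k /=; case: eqP => [->|].
Qed.

(** Antisymmetrizing a skew form multiplies it by the number of permutations.
    The cast lets the form have degree [p] when the sum ranges over the
    permutations of ['I_(p + 0)]. *)
Lemma skew_sum (E : lmodType (Cinf M)) p N (pN : p = N) (alpha : cochain M p E) xi :
  skew_cochain alpha ->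
  \sum_(s : 'S_N) (-1) ^+ s *: alpha (fun i => xi (s (cast_ord pN i))) =
  alpha (fun i => xi (cast_ord pN i)) *+ N`!.
Proof.
move=> sk; case: N / pN xi => xi.
have idE (t : 'I_p -> 'I_p) :
    (fun i => xi (t (cast_ord erefl i))) = fun i => xi (t i).
  by apply/funext => i; rewrite cast_ord_id.
transitivity (\sum_(s : 'S_p) alpha xi).
  by apply: eq_bigr => s _; rewrite idE sk scalerA -expr2 sqrr_sign scale1r.
by rewrite sumr_const (idE id) card_Sn.
Qed.

Section Pairing.
Variables (E F G : lmodType (Cinf M)) (m : E -> F -> G).
Hypotheses (m_linl : forall b, linear (m^~ b)) (m_linr : forall a, linear (m a)).

Let ml b : {linear E -> G} :=
  HB.pack (m^~ b) (GRing.isLinear.Build _ _ _ _ _ (m_linl b)).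
Let mr a : {linear F -> G} :=
  HB.pack (m a) (GRing.isLinear.Build _ _ _ _ _ (m_linr a)).

Lemma with_perm_lshift p q (xi : 'I_(p + q) -> vfield M) (s : 'S_(p + q)) k Z :
  (fun i => [eta xi with s (lshift q k) |-> Z] (s (lshift q i))) =
    [eta (fun i => xi (s (lshift q i))) with k |-> Z] :> ('I_p -> vfield M) /\
  (fun j => [eta xi with s (lshift q k) |-> Z] (s (rshift p j))) =
    (fun j => xi (s (rshift p j))).
Proof. by split; apply/funext => i /=; rewrite (inj_eq perm_inj) eq_shift. Qed.

Lemma with_perm_rshift p q (xi : 'I_(p + q) -> vfield M) (s : 'S_(p + q)) k Z :
  (fun i => [eta xi with s (rshift p k) |-> Z] (s (lshift q i))) =
    (fun i => xi (s (lshift q i))) /\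
  (fun j => [eta xi with s (rshift p k) |-> Z] (s (rshift p j))) =
    [eta (fun j => xi (s (rshift p j))) with k |-> Z] :> ('I_q -> vfield M).
Proof. by split; apply/funext => i /=; rewrite (inj_eq perm_inj) eq_shift. Qed.

Lemma wedge_skew p q (alpha : cochain M p E) (beta : cochain M q F) :
  skew_cochain (wedge m alpha beta).
Proof.
move=> t xi; rewrite /wedge scalerA mulrC -scalerA; congr (_ *: _).
rewrite scaler_sumr (reindex_inj (mulIg t^-1%g)) /=; apply: eq_bigr => s _.
rewrite scalerA odd_permM odd_permV signr_addb mulrC.
congr (_ *: m (alpha _) (beta _)); apply/funext => k.
  by rewrite permM permKV.
by rewrite permM permKV.
Qed.

Lemma wedge_form p q (alpha : cochain M p E) (beta : cochain M q F) :
  is_form alpha -> is_form beta -> is_form (wedge m alpha beta).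
Proof.
move=> [la _] [lb _]; apply: is_formP; last exact: wedge_skew.
move=> xi i f X Y; rewrite /wedge [f *: (_ *: _)]scalerA [f * _]mulrC -[in RHS]scalerA.
rewrite -scalerDr [f *: \sum_i _]scaler_sumr -big_split; congr (_ *: _).
apply: eq_bigr => s _ /=; rewrite scalerA [f * _]mulrC -scalerA -scalerDr.
congr (_ *: _); rewrite -(permKV s i).
case: (split_ordP (s^-1%g i)) => k ->.
  have W Z := with_perm_lshift xi s k Z.
  by rewrite !(proj1 (W _)) !(proj2 (W _)) la m_linl.
have W Z := with_perm_rshift xi s k Z.
by rewrite !(proj1 (W _)) !(proj2 (W _)) lb m_linr.
Qed.

(** For each permutation [s], the slot [s k] of the product that receives the
    bracket belongs to exactly one factor, so the sum over slots splits in
    two. *)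
Lemma lie_der_wedge p q (aE : vfield M -> E -> E) (aF : vfield M -> F -> F)
    (aG : vfield M -> {additive G -> G}) X
    (alpha : cochain M p E) (beta : cochain M q F) :
  (forall a b, aG X (m a b) = m (aE X a) b + m a (aF X b)) ->
  (forall c e, aG X (cinf_cst M c *: e) = cinf_cst M c *: aG X e) ->
  lie_der aG X (wedge m alpha beta) =
  wedge m (lie_der aE X alpha) beta + wedge m alpha (lie_der aF X beta).
Proof.
move=> leib aGZ; apply/funext => xi.
rewrite /lie_der /wedge !fctE aGZ -scaler_sumr -scalerBr -scalerDr.
congr (_ *: _); rewrite exchange_big raddf_sum -sumrB -big_split.
apply: eq_bigr => s _ /=; rewrite -scaler_sumr -scalerDr.
have -> e : aG X ((-1) ^+ s *: e) = (-1) ^+ s *: aG X e.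
  by rewrite -(rmorph_sign (cinf_cst M)) aGZ.
rewrite -scalerBr; congr (_ *: _).
rewrite (reindex_inj (@perm_inj _ s)) big_split_ord /= leib.
rewrite -[m (aE X _ - _) _]/(ml _ _) -[m _ (aF X _ - _)]/(mr _ _).
rewrite !raddfB (raddf_sum (ml _)) (raddf_sum (mr _)) /= opprD addrACA.
congr ((_ - _) + (_ - _)); apply: eq_bigr => k _.
  by have [-> ->] := with_perm_lshift xi s k (vbracket X (xi (s (lshift q k)))).
by have [-> ->] := with_perm_rshift xi s k (vbracket X (xi (s (rshift p k)))).
Qed.

(** The entry [X] lands, under each permutation, in one of the two factors,
    which it annihilates. *)
Lemma interior_wedge p q X (alpha : cochain M p E) (beta : cochain M q F) :
  skew_cochain alpha -> skew_cochain beta ->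
  Defs.interior X alpha = 0 -> Defs.interior X beta = 0 ->
  Defs.interior X (wedge m alpha beta) = 0.
Proof.
move=> ska skb /(interior_eq0P X ska) a0 /(interior_eq0P X skb) b0.
apply/interior_eq0P => [|i xi xiX]; first exact: wedge_skew.
rewrite /wedge big1 ?scaler0 // => s _.
move: xiX; rewrite -(permKV s i).
case: (split_ordP (s^-1%g i)) => k -> xiX.
  by rewrite (a0 k) // -[m _ _]/(ml _ _) raddf0 scaler0.
by rewrite (b0 k) // -[m _ _]/(mr _ _) raddf0 scaler0.
Qed.

Lemma wedge_comp p q (H : lmodType (Cinf M)) (h : {linear G -> H})
    (alpha : cochain M p E) (beta : cochain M q F) xi :
  h (wedge m alpha beta xi) = wedge (fun a b => h (m a b)) alpha beta xi.
Proof.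
rewrite /wedge linearZ linear_sum; congr (_ *: _).
by apply: eq_bigr => s _; rewrite linearZ.
Qed.

Lemma wedge0l q (alpha : cochain M 0 E) (beta : cochain M q F) xi eta :
  skew_cochain beta -> wedge m alpha beta xi = m (alpha eta) (beta xi).
Proof.
move=> sk; have toE t : alpha t = alpha eta by congr alpha; apply/funext; case.
have sb := skew_sum (erefl q) (xi : 'I_q -> vfield M) sk.
rewrite /wedge fact0 mul1n -[RHS](@cinf_cstVK _ _ _ _ q`!) ?fact_gt0 //.
congr (_ *: _); rewrite -[m _ _]/(mr _ _) -raddfMn /=.
transitivity (mr (alpha eta) (\sum_(s : 'S_q) (-1) ^+ s *:
    beta (fun i => xi (s (cast_ord erefl i))))).
  rewrite linear_sum; apply: eq_bigr => s _; rewrite linearZ /= toE.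
  by congr (_ *: m _ (beta _)); apply/funext => i; congr (xi (s _)); apply: val_inj.
rewrite sb; congr (mr _ (beta _ *+ _)); apply/funext => i.
by rewrite cast_ord_id.
Qed.

Lemma wedge0r p (alpha : cochain M p E) (beta : cochain M 0 F) xi eta :
  skew_cochain alpha -> wedge m alpha beta xi =
  m (alpha (fun i => xi (cast_ord (esym (addn0 p)) i))) (beta eta).
Proof.
move=> sk; have toE t : beta t = beta eta by congr beta; apply/funext; case.
have sb := skew_sum (esym (addn0 p)) xi sk.
rewrite /wedge fact0 muln1 -[RHS](@cinf_cstVK _ _ _ _ p`!) ?fact_gt0 //.
congr (_ *: _); rewrite -[m _ _]/(ml _ _) -raddfMn /=.
rewrite -(congr1 factorial (addn0 p)) -sb -[RHS]/(ml _ _).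
rewrite linear_sum; apply: eq_bigr => s _; rewrite linearZ /= toE.
by congr (_ *: m (alpha _) _); apply/funext => i; congr (xi (s _)); apply: val_inj.
Qed.

End Pairing.

Lemma wedgeN (E F G : lmodType (Cinf M)) (m : E -> F -> G) p q
    (alpha : cochain M p E) (beta : cochain M q F) xi :
  wedge (fun a b => - m a b) alpha beta xi = - wedge m alpha beta xi.
Proof.
rewrite /wedge -scalerN -sumrN; congr (_ *: _).
by apply: eq_bigr => s _; rewrite scalerN.
Qed.

(** The link between the products of scalar coordinate forms, in which the
    Froelicher-Nijenhuis bracket is expressed, and the products of the forms
    themselves: it suffices to compare the pairings value by value. *)
Lemma sum_swedgeZ p q (E F G : lmodType (Cinf M)) (m : E -> F -> G)
    (alpha : cochain M p E) (beta : cochain M q F) (I : finType)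
    (a : I -> sform M p) (b : I -> sform M q) (w : I -> G) xi :
  (forall eta theta,
     \sum_i ((a i eta : Cinf M) * (b i theta : Cinf M)) *: w i =
     m (alpha eta) (beta theta)) ->
  \sum_i (swedge (a i) (b i) xi : Cinf M) *: w i = wedge m alpha beta xi.
Proof.
move=> abE; rewrite /swedge /wedge.
set c := cinf_cst M _.
transitivity (\sum_i c *: \sum_(s : 'S_(p + q)) ((-1) ^+ s *
    ((a i (fun k => xi (s (lshift q k))) : Cinf M) *
     (b i (fun k => xi (s (rshift p k))) : Cinf M))) *: w i).
  by apply: eq_bigr => i _; rewrite -scaler_suml scalerA.
rewrite -scaler_sumr exchange_big; congr (_ *: _); apply: eq_bigr => s _ /=.
by rewrite -abE scaler_sumr; apply: eq_bigr => i _; rewrite scalerA.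
Qed.

End Wedge.

(** * Fundamental vector fields with variable coefficients *)

Section ZetaForms.
Variables (R : realType) (n : nat) (g : lieAlgType R) (M : manifold R n).
Variable zeta : inf_action g M.
Implicit Types (X Y : g) (u v : Cinfv M g).
Local Notation e_ a := ((vbasis {:g})`_a : g).
Local Notation zetav := (zeta_vfield zeta).

Fact zeta_vfield_linear : linear zetav.
Proof.
move=> f u v; apply/val_inj/funext => h; apply/val_inj/funext => x /=.
by rewrite fundamentalP.
Qed.

HB.instance Definition _ := GRing.isLinear.Build (Cinf M) (Cinfv M g)
  (vfield M) *:%R zetav zeta_vfield_linear.

Lemma zeta_vfield_cst X : zetav (cinfv_cst M X) = zeta X.
Proof. by apply/val_inj/funext => h; apply/val_inj. Qed.

Lemma zeta_vfield_decomp u : zetav u = \sum_a cinfv_coord a u *: zeta (e_ a).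
Proof.
rewrite {1}(cinfv_decomp u) linear_sum; apply: eq_bigr => a _ /=.
by rewrite linearZ /= zeta_vfield_cst.
Qed.

Lemma cinfv_lie_decompl u v :
  cinfv_lie u v = \sum_a cinfv_coord a u *: cinfv_lie (cinfv_cst M (e_ a)) v.
Proof.
rewrite cinfv_lieC {1}(cinfv_decomp u) linear_sum -sumrN.
by apply: eq_bigr => a _; rewrite /= linearZ /= -scalerN -cinfv_lieC.
Qed.

(** The coefficients are differentiated and the generators are bracketed; this
    is why equivariance of [psi] makes [zeta_psi] invariant. *)
Lemma vbracket_zeta_vfield X u :
  vbracket (zeta X) (zetav u) =
  zetav (vder (zeta X) u + cinfv_lie (cinfv_cst M X) u).
Proof.
rewrite zeta_vfield_decomp raddf_sum {3}(cinfv_decomp u) linear_sum.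
rewrite /vder -big_split linear_sum; apply: eq_bigr => a _ /=.
rewrite vbracketZr linearD !linearZ /= zeta_vfield_cst -fundamental_lie.
by congr (_ + _ *: _); rewrite -zeta_vfield_cst; congr zetav; exact: val_inj.
Qed.

(** ** Decomposition of forms along a basis of the Lie algebra *)

Definition coord_form p (phi : gform g M p) a : sform M p :=
  fun xi => cinfv_coord a (phi xi).

Lemma coord_form_is_form p (phi : gform g M p) a :
  is_form phi -> is_form (coord_form phi a).
Proof. exact: form_comp. Qed.

Lemma zeta_form_is_form p (phi : gform g M p) :
  is_form phi -> is_form (zeta_form zeta phi).
Proof. exact: form_comp. Qed.

Lemma tensor_is_form p (alpha : sform M p) (Z : vfield M) :
  is_form alpha -> is_form (tensor alpha Z).
Proof.
move=> [lin alt]; split=> [xi i f X Y|xi i j ij xij].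
  by rewrite /tensor lin scalerDl -scalerA.
by rewrite /tensor (alt _ _ _ ij xij) scale0r.
Qed.

Lemma zeta_form_decomp p (phi : gform g M p) :
  zeta_form zeta phi = \sum_a tensor (coord_form phi a) (zeta (e_ a)).
Proof.
by apply/funext => xi; rewrite fct_sumE /zeta_form zeta_vfield_decomp.
Qed.

Lemma slie_der_coord_form p (phi : gform g M p) a (Z : vfield M) :
  slie_der Z (coord_form phi a) = coord_form (lie_der (@vder _ _ M g) Z phi) a.
Proof.
apply/funext => xi; rewrite /slie_der /coord_form /lie_der raddfB /=.
by rewrite cinfv_coord_vder (raddf_sum (cinfv_coord a)).
Qed.

Lemma sextd_coord_form p (phi : gform g M p) a :
  sextd (coord_form phi a) = coord_form (gextd phi) a.
Proof.
apply/funext => xi; rewrite /sextd /gextd /coord_form /extd linearD !linear_sum.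
congr (_ + _); apply: eq_bigr => j _ /=.
  by rewrite linearZ /= cinfv_coord_vder.
by rewrite linear_sum; apply: eq_bigr => i _ /=; rewrite linearZ.
Qed.

Lemma interior_coord_form p (phi : gform g M p) a (Z : vfield M) :
  Defs.interior Z (coord_form phi a) = coord_form (Defs.interior Z phi) a.
Proof.
by case: p phi => [|p] phi //; apply/funext => xi; rewrite /coord_form raddf0.
Qed.

(** ** The Froelicher-Nijenhuis bracket of forms with fundamental values *)

Section FNBracket.
Variable FN : FN_bracket M.

Lemma FN_suml k l I (r : seq I) (K : I -> cochain M k (vfield M))
    (L : cochain M l (vfield M)) :
  (forall i, is_form (K i)) -> is_form L ->
  FN k l (\sum_(i <- r) K i) L = \sum_(i <- r) FN k l (K i) L.
Proof.
move=> fK fL.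
have FND K1 K2 : is_form K1 -> is_form K2 ->
    FN k l (K1 + K2) L = FN k l K1 L + FN k l K2 L.
  by move=> f1 f2; have := FN_linearl FN 1 f1 f2 fL; rewrite rmorph1 !scale1r.
have FN0 : FN k l 0 L = 0.
  have := FND 0 0 (form0 _ _) (form0 _ _); rewrite addr0 => e.
  by apply: (addrI (FN k l 0 L)); rewrite -e addr0.
elim: r => [|i r IH]; first by rewrite !big_nil.
by rewrite !big_cons FND ?IH //; exact: form_sum.
Qed.

Lemma FN_sumr k l I (r : seq I) (K : cochain M k (vfield M))
    (L : I -> cochain M l (vfield M)) :
  is_form K -> (forall i, is_form (L i)) ->
  FN k l K (\sum_(i <- r) L i) = \sum_(i <- r) FN k l K (L i).
Proof.
move=> fK fL.
have FND L1 L2 : is_form L1 -> is_form L2 ->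
    FN k l K (L1 + L2) = FN k l K L1 + FN k l K L2.
  by move=> f1 f2; have := FN_linearr FN 1 fK f1 f2; rewrite rmorph1 !scale1r.
have FN0 : FN k l K 0 = 0.
  have := FND 0 0 (form0 _ _) (form0 _ _); rewrite addr0 => e.
  by apply: (addrI (FN k l K 0)); rewrite -e addr0.
elim: r => [|i r IH]; first by rewrite !big_nil.
by rewrite !big_cons FND ?IH //; exact: form_sum.
Qed.

(** What is left is the part of the bracket that involves contractions by
    fundamental fields: of the three other terms, those with a Lie derivative
    each contribute [- zeta_[phi, psi]] by equivariance, and the bracket of the
    generators contributes [zeta_[phi, psi]]. *)
Lemma FN_zeta_form p q (phi : gform g M p) (psi : gform g M q) :
  invariant_gform zeta phi -> invariant_gform zeta psi ->
  FN p q (zeta_form zeta phi) (zeta_form zeta psi) =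
  - zeta_form zeta (gform_bracket phi psi) + (-1) ^+ p *:
    \sum_(a < \dim {:g}) \sum_(b < \dim {:g})
      (tensor (extd_wedge_interior (zeta (e_ a)) (coord_form phi a)
                 (coord_form psi b)) (zeta (e_ b)) +
       tensor (interior_wedge_extd (zeta (e_ b)) (coord_form phi a)
                 (coord_form psi b)) (zeta (e_ a))).
Proof.
move=> [fphi ephi] [fpsi epsi].
have fa := fun a => coord_form_is_form a fphi.
have fb := fun b => coord_form_is_form b fpsi.
rewrite !zeta_form_decomp FN_suml; last first.
- by apply: form_sum => b; exact: tensor_is_form.
- by move=> a; exact: tensor_is_form.
under eq_bigr => a _.
  rewrite FN_sumr; [|exact: tensor_is_form|by move=> b; exact: tensor_is_form].
  under eq_bigr => b _ do rewrite FN_tensor //.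
  rewrite big_split -scaler_sumr; over.
rewrite big_split -scaler_sumr -zeta_form_decomp; congr (_ + _).
apply/funext => xi; rewrite fct_sumE.
under eq_bigr => a _ do rewrite fct_sumE.
rewrite pair_bigA /=.
under eq_bigr => ab _ do rewrite !fctE /tensor.
rewrite !big_split /= sumrN.
rewrite (@sum_swedgeZ _ _ _ _ _ _ _ _ (fun u v => zetav (cinfv_lie u v))
  phi psi); last first.
  move=> eta theta; rewrite cinfv_lieE linear_sum -(pair_bigA _
    (fun a b : 'I_(\dim {:g}) => (coord_form phi a eta * coord_form psi b theta : Cinf M) *:
      vbracket (zeta (e_ a)) (zeta (e_ b)))) /=.
  apply: eq_bigr => a _; rewrite linear_sum; apply: eq_bigr => b _ /=.
  by rewrite linearZ /= zeta_vfield_cst fundamental_lie.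
(* L_(zeta_a) psi = - [e_a, psi] *)
rewrite (@sum_swedgeZ _ _ _ _ _ _ _ _ (fun u v => - zetav (cinfv_lie u v))
  phi psi); last first.
  move=> eta theta; rewrite -(pair_bigA _
    (fun a b : 'I_(\dim {:g}) => (coord_form phi a eta *
        slie_der (zeta (e_ a)) (coord_form psi b) theta : Cinf M) *:
      zeta (e_ b))) /=.
  rewrite cinfv_lie_decompl linear_sum -sumrN; apply: eq_bigr => a _ /=.
  rewrite linearZ /= zeta_vfield_decomp -scalerN -sumrN scaler_sumr.
  apply: eq_bigr => b _; rewrite slie_der_coord_form epsi /coord_form.
  by rewrite raddfN -scaleNr scalerA.
(* L_(zeta_b) phi = - [e_b, phi], and [e_b, phi] = - [phi, e_b] *)
rewrite (@sum_swedgeZ _ _ _ _ _ _ _ _ (fun u v => zetav (cinfv_lie u v))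
  phi psi); last first.
  move=> eta theta; rewrite -(pair_bigA _
    (fun a b : 'I_(\dim {:g}) => (slie_der (zeta (e_ b)) (coord_form phi a) eta *
        coord_form psi b theta : Cinf M) *: zeta (e_ a))) exchange_big /=.
  rewrite cinfv_lieC cinfv_lie_decompl linearN linear_sum -sumrN.
  apply: eq_bigr => b _ /=.
  rewrite linearZ /= zeta_vfield_decomp -scalerN -sumrN scaler_sumr.
  apply: eq_bigr => a _; rewrite slie_der_coord_form ephi /coord_form.
  by rewrite raddfN -scaleNr scalerA mulrC.
by rewrite wedgeN addrN add0r -(wedge_comp _ zetav).
Qed.

End FNBracket.

End ZetaForms.

(** * The bracket relations *)

Section MainComputations.
Variables (R : realType) (n : nat) (g : lieAlgType R) (M : manifold R n).
Variables (zeta : inf_action g M) (FN : FN_bracket M).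
Local Notation e_ a := ((vbasis {:g})`_a : g).
Local Notation zetav := (zeta_vfield zeta).

Lemma swedge_zero p q (alpha : sform M p) (beta : sform M q) :
  alpha = 0 \/ beta = 0 -> swedge alpha beta = 0.
Proof.
move=> ab0; apply/funext => xi; rewrite /swedge /wedge big1 ?scaler0 // => s _.
by case: ab0 => ->; rewrite ?[0 * _](mul0r) ?[_ * 0](mulr0) scaler0.
Qed.

Lemma extd_wedge_interior_eq0 Z k l (alpha : sform M k) (beta : sform M l) :
  Defs.interior Z beta = 0 -> extd_wedge_interior Z alpha beta = 0.
Proof.
case: l beta => [//|l] beta b0; apply/funext => xi /=.
by rewrite swedge_zero //; right.
Qed.

Lemma interior_wedge_extd_eq0 Z k l (alpha : sform M k) (beta : sform M l) :
  Defs.interior Z alpha = 0 -> interior_wedge_extd Z alpha beta = 0.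
Proof.
case: k alpha => [//|k] alpha a0; apply/funext => xi /=.
by rewrite swedge_zero //; left.
Qed.

Lemma tensor0 p (Z : vfield M) : tensor (0 : sform M p) Z = 0.
Proof. by apply/funext => xi; rewrite /tensor scale0r. Qed.

Lemma coord_form_hor p (phi : gform g M p) a X :
  horizontal zeta phi -> Defs.interior (zeta X) (coord_form phi a) = 0.
Proof.
by move=> hphi; rewrite interior_coord_form hphi; apply/funext => xi;
  rewrite /coord_form raddf0.
Qed.

(** Horizontality removes every term with a contraction. *)
Lemma FN_zeta_hor p q (phi : gform g M p) (psi : gform g M q) :
  hor_invariant_gform zeta phi -> hor_invariant_gform zeta psi ->
  FN p q (zeta_form zeta phi) (zeta_form zeta psi) =
  - zeta_form zeta (gform_bracket phi psi).
Proof.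
move=> [iphi hphi] [ipsi hpsi]; rewrite FN_zeta_form //.
rewrite big1 ?scaler0 ?addr0 // => a _; rewrite big1 // => b _.
rewrite extd_wedge_interior_eq0 ?interior_wedge_extd_eq0 ?coord_form_hor //.
by rewrite !tensor0 addr0.
Qed.

Lemma zeta_form_horizontal q (psi : gform g M q) :
  horizontal zeta psi -> horizontal zeta (zeta_form zeta psi).
Proof.
move=> hpsi X; case: q psi hpsi => [|q] psi hpsi //.
apply/funext => xi; have := congr1 (fun f => zetav (f xi)) (hpsi X).
by rewrite linear0.
Qed.

Lemma lie_der_zeta_form q (psi : gform g M q) X :
  equivariant zeta psi ->
  lie_der (@vbracket R n M) (zeta X) (zeta_form zeta psi) = 0.
Proof.
move=> epsi; apply/funext => xi; rewrite /lie_der vbracket_zeta_vfield.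
rewrite -[X in _ - X](linear_sum zetav) -linearB addrAC.
have := congr1 (fun f => f xi) (epsi X); rewrite /lie_der => ->.
by rewrite addNr linear0.
Qed.

(** With [1 (x) zeta_X] as first argument, the terms [psi^b (x) [zeta_X, zeta_b]]
    and [L_(zeta_X) psi^b (x) zeta_b] add up to [zeta_[X, psi]] and
    [- zeta_[X, psi]]. *)
Lemma FN_vform0_zeta_form q (psi : gform g M q) X :
  hor_invariant_gform zeta psi ->
  FN 0%N q (vform0 (zeta X)) (zeta_form zeta psi) = 0.
Proof.
move=> [[fpsi epsi] hpsi]; pose one : sform M 0 := fun=> 1.
have fone : is_form one by split=> ? [].
have fb := fun b => coord_form_is_form b fpsi.
have -> : vform0 (zeta X) = tensor one (zeta X).
  by apply/funext => xi; rewrite /tensor /one scale1r.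
rewrite zeta_form_decomp FN_sumr; last first.
- by move=> b; exact: tensor_is_form.
- exact: tensor_is_form.
under eq_bigr => b _.
  rewrite FN_tensor // extd_wedge_interior_eq0 ?coord_form_hor //.
  rewrite interior_wedge_extd_eq0 // !tensor0 addr0 scaler0 addr0.
  rewrite (swedge_zero (alpha := slie_der _ one)); last first.
    left; apply/funext => xi.
    by rewrite /slie_der /lie_der big_ord0 subr0 /one -(rmorph1 (cinf_cst M)) vfield_cst.
  rewrite tensor0 subr0; over.
apply/funext => xi; rewrite fct_sumE.
under eq_bigr => b _ do rewrite fctE /tensor.
rewrite big_split /=.
pose m (f : (Cinf M)^o) v := (f : Cinf M) *: zetav (cinfv_lie (cinfv_cst M X) v).
rewrite (@sum_swedgeZ _ _ _ _ _ _ _ _ m one psi); last first.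
  move=> eta theta; rewrite /m (cinfv_decomp (psi theta)) linear_sum.
  rewrite linear_sum scaler_sumr; apply: eq_bigr => b _ /=.
  rewrite !linearZ /= scalerA mulrC; congr (_ *: _).
  by rewrite -fundamental_lie -zeta_vfield_cst; congr zetav; exact: val_inj.
rewrite (@sum_swedgeZ _ _ _ _ _ _ _ _ (fun f v => - m f v) one psi).
  by rewrite wedgeN addrN.
move=> eta theta; rewrite /m zeta_vfield_decomp -scalerN -sumrN scaler_sumr.
apply: eq_bigr => b _; rewrite slie_der_coord_form epsi /coord_form.
by rewrite raddfN -scaleNr scalerA.
Qed.

(** ** Invariant horizontal forms are closed under the bracket *)

Lemma hor_invariantP p (c : R) (phi psi : gform g M p) :
  hor_invariant_gform zeta phi -> hor_invariant_gform zeta psi ->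
  hor_invariant_gform zeta (cinf_cst M c *: phi + psi).
Proof.
move=> [[fphi ephi] hphi] [[fpsi epsi] hpsi]; split; [split|].
- exact: formP.
- move=> X; transitivity (cinf_cst M c *: lie_der (@vder _ _ M g) (zeta X) phi +
    lie_der (@vder _ _ M g) (zeta X) psi).
    apply/funext => xi; rewrite /lie_der !fctE raddfD /= vder_cstZ big_split.
    by rewrite -scaler_sumr /= scalerBr opprD addrACA.
  rewrite ephi epsi; apply/funext => xi; rewrite !fctE linearP.
  by rewrite opprD scalerN.
- move=> X; transitivity (cinf_cst M c *: Defs.interior (zeta X) phi +
    Defs.interior (zeta X) psi); last by rewrite hphi hpsi scaler0 addr0.
  case: p phi psi {fphi ephi hphi fpsi epsi hpsi} => [|p] phi psi //.
  by apply/funext => xi; rewrite /= scaler0 addr0.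
Qed.

(** Equivariance of the bracket is the Jacobi identity, [L_(zeta_X)] being a
    derivation of the wedge product. *)
Lemma hor_invariant_bracket p q (phi : gform g M p) (psi : gform g M q) :
  hor_invariant_gform zeta phi -> hor_invariant_gform zeta psi ->
  hor_invariant_gform zeta (gform_bracket phi psi).
Proof.
move=> [[fphi ephi] hphi] [[fpsi epsi] hpsi].
have ll := @cinfv_lie_linearl R n M g; have lr := @cinfv_lie_linearr R n M g.
split; [split|].
- exact: wedge_form.
- move=> X; rewrite /gform_bracket.
  rewrite (@lie_der_wedge _ _ _ _ _ _ _ ll lr _ _ (@vder _ _ M g)
    (@vder _ _ M g) (fun Z => @vder _ _ M g Z)); last 2 first.
  + by move=> a b; exact: vder_lie.
  + by move=> c e; exact: vder_cstZ.
  rewrite ephi epsi; apply/funext => xi; rewrite fctE.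
  rewrite (wedge_comp _ (cinfv_lie (cinfv_cst M X))) /wedge -scalerN -scalerDr.
  rewrite -sumrN -big_split; congr (_ *: _); apply: eq_bigr => s _ /=.
  rewrite -scalerDr -scalerN; congr (_ *: _); rewrite raddfN /=.
  by rewrite [in RHS]cinfv_lie_jacobi opprD cinfv_lieC raddfN /= -cinfv_lieC.
- by move=> X; apply: interior_wedge => //; exact: form_skew.
Qed.

Lemma zeta_antihom : graded_Lie_antihom
  (fun k => @hor_invariant_gform R n g M zeta k)
  (fun k => @is_form R n M k (vfield M))
  (@gform_bracket R n g M) FN (@zeta_form R n g M zeta).
Proof.
split.
- move=> p c a a' ha ha'; split; first exact: hor_invariantP.
  by apply/funext => xi; exact: (linearP zetav).
- by move=> p a [[fa _] _]; exact: zeta_form_is_form.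
- by move=> p q a b; exact: hor_invariant_bracket.
- by move=> p q a b; exact: FN_zeta_hor.
Qed.

(** ** Principal connections *)

Section Connection.
Variable omega : gform g M 1.
Hypothesis omega_conn : principal_connection_form zeta omega.

Let omega_inv : invariant_gform zeta omega. Proof. by case: omega_conn. Qed.

(** [zeta o omega o zeta = zeta] as an identity of vector fields. *)
Lemma zeta_connection X : zetav (omega (fun=> zeta X)) = zeta X.
Proof.
apply/val_inj/funext => f; apply/val_inj/funext => x.
by have [_ /(_ x X) /(congr1 (fun D => D f))] := omega_conn.
Qed.

Lemma interior_connection Z a eta :
  Defs.interior Z (coord_form omega a) eta = cinfv_coord a (omega (fun=> Z)).
Proof.
congr (cinfv_coord a (omega _)); apply/funext => k.
by case: unliftP => [[]|].
Qed.

Let mulrl (b : (Cinf M)^o) : linear (fun a : (Cinf M)^o => (a * b : (Cinf M)^o)).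
Proof. by move=> c u v; rewrite -[c *: u]/(c * u) mulrDl -mulrA. Qed.

Let mulrr (a : (Cinf M)^o) : linear (fun b : (Cinf M)^o => (a * b : (Cinf M)^o)).
Proof. by move=> c u v; rewrite -[c *: u]/(c * u) mulrDr mulrCA. Qed.

Lemma vfield_actN (X : vfield M) (e : (Cinf M)^o) : X (- e) = - X e.
Proof. exact: raddfN. Qed.

(** [i_(zeta_b) omega^a] is a function: wedging with it is a multiplication,
    and summing over [a] gives [zeta_(omega (zeta_b)) = zeta_b]. *)
Lemma sum_interior_wedge_extd q (psi : gform g M q) : is_form psi ->
  \sum_(a < \dim {:g}) \sum_(b < \dim {:g})
    tensor (interior_wedge_extd (zeta (e_ b)) (coord_form omega a)
              (coord_form psi b)) (zeta (e_ a)) =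
  zeta_form zeta (gextd psi).
Proof.
move=> fpsi; apply/funext => xi; rewrite exchange_big fct_sumE.
rewrite /zeta_form zeta_vfield_decomp; apply: eq_bigr => b _.
rewrite fct_sumE -[in RHS]zeta_connection zeta_vfield_decomp scaler_sumr.
apply: eq_bigr => a _; rewrite /tensor /interior_wedge_extd /swedge.
have sk : skew_cochain (sextd (coord_form psi b)).
  exact: (extd_skew vfield_actN) (coord_form_is_form b fpsi).
rewrite (wedge0l mulrr _ _ (fun=> 0)) //.
rewrite interior_connection sextd_coord_form /coord_form scalerA mulrC.
congr ((cinfv_coord b (gextd psi _) * _) *: _).
by apply/funext => i; congr (xi _); exact: val_inj.
Qed.

Lemma sum_extd_wedge_interior :
  \sum_(a < \dim {:g}) \sum_(b < \dim {:g})
    tensor (extd_wedge_interior (zeta (e_ a)) (coord_form omega a)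
              (coord_form omega b)) (zeta (e_ b)) =
  zeta_form zeta (gextd omega).
Proof.
apply/funext => xi; rewrite fct_sumE.
rewrite /zeta_form zeta_vfield_decomp; apply: eq_bigr => a _.
rewrite fct_sumE -[in RHS]zeta_connection zeta_vfield_decomp scaler_sumr.
apply: eq_bigr => b _; rewrite /tensor /extd_wedge_interior /swedge.
have sk : skew_cochain (sextd (coord_form omega a)).
  exact: (extd_skew vfield_actN) (coord_form_is_form a (proj1 omega_inv)).
rewrite (wedge0r mulrl _ _ (fun=> 0)) //.
rewrite interior_connection sextd_coord_form /coord_form scalerA.
congr ((cinfv_coord a (gextd omega _) * _) *: _).
by apply/funext => i; congr (xi _); exact: val_inj.
Qed.

Lemma FN_connection q (psi : gform g M q) : hor_invariant_gform zeta psi ->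
  FN 1%N q (zeta_form zeta omega) (zeta_form zeta psi) =
  - zeta_form zeta (gextd psi + gform_bracket omega psi).
Proof.
move=> [ipsi hpsi]; rewrite FN_zeta_form // expr1 scaleN1r.
under eq_bigr => a _.
  under eq_bigr => b _.
    rewrite extd_wedge_interior_eq0 ?coord_form_hor // tensor0 add0r; over.
  over.
rewrite sum_interior_wedge_extd; last by case: ipsi.
by rewrite -opprD addrC; congr (- _); apply/funext => xi; rewrite /zeta_form raddfD.
Qed.

Lemma FN_curvature :
  cinf_cst M 2%:R^-1 *: FN 1%N 1%N (zeta_form zeta omega) (zeta_form zeta omega) =
  - zeta_form zeta (gextd omega + cinf_cst M 2%:R^-1 *: gform_bracket omega omega).
Proof.
rewrite FN_zeta_form // expr1 scaleN1r.
under eq_bigr => a _ do rewrite big_split.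
rewrite big_split /= sum_extd_wedge_interior sum_interior_wedge_extd; last first.
  by case: omega_inv.
rewrite -mulr2n scalerBr scalerN cinf_cstVK // -opprD addrC; congr (- _).
by apply/funext => xi; rewrite /zeta_form raddfD /= linearZ.
Qed.

End Connection.

End MainComputations.

Theorem proposition4p4 (R : realType) (n : nat) (g : lieAlgType R)
  (M : manifold R n) (zeta : inf_action g M) (FN : FN_bracket M)
  (p q : nat) (phi : gform g M p) (psi : gform g M q)
  (hphi : hor_invariant_gform zeta phi)
  (hpsi : hor_invariant_gform zeta psi) :
  [/\ (* (1) *)
      horizontal zeta (zeta_form zeta psi) /\
      (forall X : g,
         lie_der (@vbracket R n M) (zeta X) (zeta_form zeta psi) =
           FN 0%N q (vform0 (zeta X)) (zeta_form zeta psi) /\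
         FN 0%N q (vform0 (zeta X)) (zeta_form zeta psi) = 0),
      (* (2) *)
      FN p q (zeta_form zeta phi) (zeta_form zeta psi) =
        - zeta_form zeta (gform_bracket phi psi) /\
      graded_Lie_antihom
        (fun k => @hor_invariant_gform R n g M zeta k)
        (fun k => @is_form R n M k (vfield M))
        (@gform_bracket R n g M) FN (@zeta_form R n g M zeta) &
      forall omega : gform g M 1, principal_connection_form zeta omega ->
        let Phi := zeta_form zeta omega in
        (* (3) *)
        FN 1%N q Phi (zeta_form zeta psi) =
          - zeta_form zeta (gextd psi + gform_bracket omega psi) /\
        (* (4) *)
        cinf_cst M 2%:R^-1 *: FN 1%N 1%N Phi Phi =
          - zeta_form zeta (gextd omega +
              cinf_cst M 2%:R^-1 *: gform_bracket omega omega)].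
Proof.
have [[_ epsi] hor_psi] := hpsi.
split; first split; first exact: zeta_form_horizontal.
- by move=> X; rewrite lie_der_zeta_form // FN_vform0_zeta_form.
- by split; [exact: FN_zeta_hor | exact: zeta_antihom].
- by move=> omega homega Phi; split; [exact: FN_connection | exact: FN_curvature].
Qed.
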